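(* Under the hypotheses of the setting below ($f$ continuous satisfying Assumption 1 on $R\times I$ with $R=[-1,1]^n$, unique implicit function $g:R\to I$ whose power series at $0$ converges on $[-1-\delta,1+\delta]^n$ for some $\delta>0$), for each $N\ge1$ define $$\tilde g_N(x)=\sum_{0\le\beta\le N-1}\tilde c_\beta x^\beta,\qquad \tilde c_\beta=\prod_{k=1}^n(\beta_k+1)\sum_{1\le\alpha\le N}\prod_{k=1}^n\big(V_N^{-1}\big)_{\beta_k+1,\alpha_k}\,d_\alpha .$$ Then $\tilde g_N\to g$ weak-star in $L^\infty(R)$ as $N\to\infty$.
   Context: Multi-index notation: $\alpha\le\beta$ componentwise, $x^\beta=\prod_kx_k^{\beta_k}$, an integer $N$ used as a multi-index means $(N,\dots,N)$. $\operatorname{sign}_y f(x,y)=1$ if $f(x,y)\ge0$ and $-1$ otherwise; $\Theta_y f(x,y)=1$ if $f(x,y)\ge0$ and $0$ otherwise. Assumption 1 on $R\times I$: for every $x\in R$, $y\mapsto\operatorname{sign}_y f(x,y)$ has exactly one jump discontinuity on $I$. $n_y(f)\in\{1,-1\}$ is $1$ if $y\mapsto\operatorname{sign}_y f(x,y)$ is increasing on $I$ and $-1$ if decreasing (constant on $R$). $\Delta=2/N$; $R_\alpha=\prod_{k=1}^n[-1+(\alpha_k-1)\Delta,-1+\alpha_k\Delta]$; $V_N$ is the $N\times N$ matrix with entry in row $i$, column $j$ equal to $(-1+i\Delta)^j-(-1+(i-1)\Delta)^j$; $d_\alpha=\frac{1+n_y(f)}{2}|R_\alpha|\max I+\frac{1-n_y(f)}{2}|R_\alpha|\min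 I-n_y(f)\iint_{R_\alpha\times I}\Theta_y f\,dx\,dy$. *)

(* Defs.v *)
From HB Require Import structures.
From mathcomp Require Import all_boot all_order all_algebra.
From mathcomp Require Import all_classical all_reals all_analysis.
Set Implicit Arguments. Unset Strict Implicit. Unset Printing Implicit Defensive.
Import Order.TTheory GRing.Theory Num.Theory.
Import numFieldNormedType.Exports.
Local Open Scope classical_set_scope.
Local Open Scope ring_scope.

Definition sgnR (R : realType) (t : R) : R := if 0 <= t then 1 else -1.
Definition ThetaR (R : realType) (t : R) : R := if 0 <= t then 1 else 0.

Definition mono (R : realType) (n : nat) (x : n.-tuple R) (beta : 'I_n -> nat) : R :=
  \prod_(k < n) tnth x k ^+ beta k.

Definition in_cube (R : realType) (n : nat) (r : R) (x : n.-tuple R) : Prop :=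
  forall k : 'I_n, `|tnth x k| <= r.

(* Iterated Lebesgue integral over the box prod_k [B_k.1, B_k.2]
   (integrate the first coordinate outermost).  By Tonelli/Fubini this is
   the Lebesgue integral over the box for nonnegative or integrable
   (Borel) functions. *)
Fixpoint iint (R : realType) (n : nat) :
    (n.-tuple R -> \bar R) -> n.-tuple (R * R) -> \bar R :=
  match n with
  | 0 => fun F _ => F [tuple]
  | m.+1 => fun F B =>
      (\int[@lebesgue_measure R]_(x in `[(thead B).1, (thead B).2])
          iint (fun t : m.-tuple R => F [tuple of x :: t]) [tuple of behead B])%E
  end.

Definition cube (R : realType) (n : nat) : n.-tuple (R * R) :=
  [tuple ((-1 : R), (1 : R)) | i < n].

Definition Delta (R : realType) (N : nat) : R := 2 / N%:R.

(* R_alpha, with alpha given 0-based: alpha_k (paper) = val (al k) + 1, so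
   R_alpha = prod_k [-1 + al_k Delta, -1 + (al_k + 1) Delta]. *)
Definition Rbox (R : realType) (n N : nat) (al : {ffun 'I_n -> 'I_N}) :
    n.-tuple (R * R) :=
  [tuple (-1 + (al i)%:R * Delta R N, -1 + (al i).+1%:R * Delta R N) | i < n].

Definition VN (R : realType) (N : nat) : 'M[R]_N :=
  \matrix_(i < N, j < N)
    ((-1 + i.+1%:R * Delta R N) ^+ j.+1 - (-1 + i%:R * Delta R N) ^+ j.+1).

(* d_alpha, with I = [a, b], ny = n_y(f) and |R_alpha| = Delta^n *)
Definition dcoef (R : realType) (n N : nat) (f : n.-tuple R -> R -> R)
    (a b ny : R) (al : {ffun 'I_n -> 'I_N}) : R :=
  (1 + ny) / 2 * Delta R N ^+ n * b + (1 - ny) / 2 * Delta R N ^+ n * a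
  - ny * fine (iint (fun x => \int[@lebesgue_measure R]_(y in `[a, b])
                                 (ThetaR (f x y))%:E)%E (Rbox R al)).

Definition ctilde (R : realType) (n N : nat) (f : n.-tuple R -> R -> R)
    (a b ny : R) (be : {ffun 'I_n -> 'I_N}) : R :=
  (\prod_(k < n) (be k).+1%:R) *
  \sum_(al : {ffun 'I_n -> 'I_N})
     (\prod_(k < n) invmx (VN R N) (be k) (al k)) * dcoef f a b ny al.

Definition gtilde (R : realType) (n N : nat) (f : n.-tuple R -> R -> R)
    (a b ny : R) (x : n.-tuple R) : R :=
  \sum_(be : {ffun 'I_n -> 'I_N}) ctilde f a b ny be * mono x (fun k => val (be k)).

Definition ps_partial (R : realType) (n : nat) (c : ('I_n -> nat) -> R)
    (x : n.-tuple R) (M : nat) : R :=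
  \sum_(be : {ffun 'I_n -> 'I_M.+1})
     c (fun k => val (be k)) * mono x (fun k => val (be k)).

Definition ps_abs_partial (R : realType) (n : nat) (c : ('I_n -> nat) -> R)
    (x : n.-tuple R) (M : nat) : R :=
  \sum_(be : {ffun 'I_n -> 'I_M.+1})
     `|c (fun k => val (be k)) * mono x (fun k => val (be k))|.

Definition cont_on (R : realType) (n : nat) (f : n.-tuple R -> R -> R) (a b : R) : Prop :=
  forall x y, in_cube 1 x -> a <= y <= b ->
  forall e : R, 0 < e -> exists2 d : R, 0 < d &
    forall x' y', in_cube 1 x' -> a <= y' <= b ->
      (forall k, `|tnth x' k - tnth x k| < d) -> `|y' - y| < d ->
      `|f x' y' - f x y| < e.

(* Assumption 1: for every x in R, y |-> sign_y f(x,y) has exactly one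
   (jump) discontinuity on I = [a,b] (for a {-1,1}-valued function a unique
   discontinuity point is automatically a jump). *)
Definition assumption1 (R : realType) (n : nat) (f : n.-tuple R -> R -> R) (a b : R) : Prop :=
  forall x, in_cube 1 x ->
    exists! y0 : R, a <= y0 <= b /\
      ~ ((fun y => sgnR (f x y)) @ within `[a, b] (nbhs y0) --> sgnR (f x y0)).

Definition ny_spec (R : realType) (n : nat) (f : n.-tuple R -> R -> R) (a b ny : R) : Prop :=
  (ny = 1 /\ forall x, in_cube 1 x -> forall y1 y2, a <= y1 -> y1 <= y2 -> y2 <= b ->
      sgnR (f x y1) <= sgnR (f x y2))
  \/
  (ny = -1 /\ forall x, in_cube 1 x -> forall y1 y2, a <= y1 -> y1 <= y2 -> y2 <= b ->
      sgnR (f x y2) <= sgnR (f x y1)).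

(* Main.v *)
Require Import Defs.
From HB Require Import structures.
From mathcomp Require Import all_boot all_order all_algebra.
From mathcomp Require Import all_classical all_reals all_analysis.
From mathcomp Require Import measurable_realfun ring lra zify.
Set Implicit Arguments. Unset Strict Implicit. Unset Printing Implicit Defensive.
Import Order.TTheory GRing.Theory Num.Theory.
Import numFieldNormedType.Exports.
Local Open Scope classical_set_scope.
Local Open Scope ring_scope.

(* Integrating Theta in y shows that d_alpha is the integral of g over R_alpha,
   so gtilde_N is the polynomial of degree < N in each variable having the cell
   averages of g.  On monomials this operator is a tensor product: x ^ beta goes
   to the product of the one-variable interpolants P_N(beta_k), and
   P_N(j) = (L (t ^ (j+1)))' / (j+1) with L the Lagrange interpolation at the
   N+1 equispaced nodes.  It is exact for j < N.

   The point is the bound |P_N(j)| <= C (1+d)^j on [-1,1], uniform in N and j.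
   Write t ^ (j+1) = w q + L (t ^ (j+1)) with w the node polynomial.  As the
   nodes are symmetric, w is a product of factors X and X^2 - s with s >= 0, and
   division by these preserves nonnegativity of coefficients; hence
   |q| and d |q'| are at most q(1+d) <= (1+d)^(j+1) / w(1+d).  With
   M = N! (2/N)^N one has |w| <= 2 M and |w'| <= (N+1) M on [-1,1] but
   w(1+d) >= d M, so there is no Runge phenomenon.

   Summing against the coefficients of g, which are absolutely summable at
   1+d, gives gtilde_N -> g uniformly on the cube, hence weak-star. *)

(** * Division of polynomials with nonnegative coefficients *)

Definition nonneg_poly (R : realFieldType) (p : {poly R}) : Prop :=
  forall i, 0 <= p`_i.

Lemma nonneg_poly_horner (R : realFieldType) (p : {poly R}) (r : R) :
  nonneg_poly p -> 0 <= r -> 0 <= p.[r].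
Proof.
move=> p0 r0; rewrite horner_coef; apply: sumr_ge0 => i _.
by rewrite mulr_ge0 ?exprn_ge0.
Qed.

Lemma nonneg_poly_horner_le (R : realFieldType) (p : {poly R}) (r x : R) :
  nonneg_poly p -> `|x| <= r -> `|p.[x]| <= p.[r].
Proof.
move=> p0 xr; rewrite !horner_coef.
apply: le_trans (ler_norm_sum _ _ _) _; apply: ler_sum => i _.
rewrite normrM normrX ger0_norm ?p0//; apply: ler_wpM2l; first exact: p0.
by apply: lerXn2r; rewrite ?nnegrE// (le_trans _ xr).
Qed.

(** On the unit interval the derivative is at most its value at 1; termwise the claim is then
    [i * d <= (1 + d) ^+ i], Bernoulli's inequality. *)
Lemma nonneg_poly_deriv_le (R : realFieldType) (p : {poly R}) (d x : R) :
  nonneg_poly p -> 0 < d -> `|x| <= 1 -> `|p^`().[x]| <= p.[1 + d] / d.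
Proof.
move=> p0 d0 x1.
have dp0 : nonneg_poly p^`() by move=> i; rewrite coef_deriv mulrn_wge0.
apply: le_trans (nonneg_poly_horner_le dp0 x1) _.
rewrite ler_pdivlMr// -[p in p^`()]coefK poly_def.
rewrite raddf_sum /= horner_sum mulr_suml horner_coef; apply: ler_sum => i _.
rewrite derivZ hornerZ derivXn -mulrA; apply: ler_wpM2l; first exact: p0.
rewrite hornerMn hornerXn expr1n.
elim: (i : nat) => [|k IH]; first by rewrite mulr0n mul0r expr0.
rewrite exprS mulrDl mul1r.
have : 1 <= (1 + d) ^+ k by rewrite exprn_ege1// lerDl ltW.
rewrite mulrS; nra.
Qed.

(** The last clause says that the remainder is nonnegative at [r]. Nonnegative coefficients of the
    remainder can be lost under products of divisors; its sign at [r] is kept. *)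
Definition pos_divisor (R : realFieldType) (r : R) (w : {poly R}) : Prop :=
  [/\ w \is monic, 0 <= w.[r] &
   forall p : {poly R}, nonneg_poly p -> exists q s : {poly R},
     [/\ nonneg_poly q, p = q * w + s, (size s < size w)%N &
         q.[r] * w.[r] <= p.[r]]].

Lemma pos_divisor1 (R : realFieldType) (r : R) : pos_divisor r 1.
Proof.
split; rewrite ?monic1 ?hornerC// => p p0; exists p, 0; split => //.
- by rewrite mulr1 addr0.
- by rewrite size_poly0 size_poly1.
- by rewrite mulr1.
Qed.

(** Divide by [v], then the quotient by [w]: the remainders combine to [u * v + s], and the values
    at [r] chain because [v] is nonnegative there. *)
Lemma pos_divisorM (R : realFieldType) (r : R) (v w : {poly R}) :
  pos_divisor r v -> pos_divisor r w -> pos_divisor r (v * w).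
Proof.
move=> [mv v0 dv] [mw w0 dw]; split.
- by rewrite monicMl.
- by rewrite hornerM mulr_ge0.
move=> p /dv[q [s [q0 -> sv qv]]]; have [t [u [t0 -> uw tw]]] := dw _ q0.
exists t, (u * v + s); split => //.
- by ring.
- have vwE : size (v * w) = (size v + size w).-1.
    by rewrite size_monicM ?monic_neq0.
  rewrite (leq_ltn_trans (size_polyD _ _))// gtn_max vwE.
  apply/andP; split; last by move: sv uw; lia.
  have [->|u_neq0] := eqVneq u 0; first by rewrite mul0r size_poly0; lia.
  by rewrite size_Mmonic//; lia.
- move: qv tw; rewrite !(hornerD, hornerM) => qv tw.
  nra.
Qed.

Lemma pos_divisorX (R : realFieldType) (r : R) : 0 <= r -> pos_divisor r 'X.
Proof.
move=> r0; split; rewrite ?monicX ?hornerX//.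
elim/poly_ind => [|p c _] p0.
  exists 0, 0; split => //; first by rewrite mul0r addr0.
    by rewrite size_poly0 size_polyX.
  by rewrite !horner0 mul0r.
exists p, c%:P; split => //.
- by move=> i; have := p0 i.+1; rewrite -cons_poly_def coef_cons.
- by rewrite size_polyX (leq_ltn_trans (size_polyC_leq1 _)).
- rewrite !hornerE lerDl.
  by have := p0 0%N; rewrite -cons_poly_def coef_cons.
Qed.

Lemma pos_divisor_sub_sqr (R : realFieldType) (r s : R) :
  0 <= s <= r ^+ 2 -> 0 <= r -> pos_divisor r ('X^2 - s%:P).
Proof.
move=> /andP[s0 sr] r0; split.
- by rewrite monicXnsubC.
- by rewrite !hornerE subr_ge0.
move=> p p0.
(* The remainder is taken with nonnegative coefficients, a stronger claim that the induction on [p]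
   can carry. *)
suff [q [c [d [q0 c0 d0 pE]]]] : exists (q : {poly R}) (c d : R),
    [/\ nonneg_poly q, 0 <= c, 0 <= d & p = q * ('X^2 - s%:P) + (c *: 'X + d%:P)].
  exists q, (c *: 'X + d%:P); split => //.
  - rewrite size_XnsubC// (leq_ltn_trans (size_polyD _ _))// gtn_max.
    rewrite (leq_ltn_trans (size_scale_leq _ _)) ?size_polyX//=.
    by rewrite (leq_ltn_trans (size_polyC_leq1 _)).
  - by rewrite pE [leRHS]hornerD hornerM lerDl hornerD hornerZ hornerX hornerC addr_ge0// mulr_ge0.
elim/poly_ind: p p0 => [|p e IH] p0.
  exists 0, 0, 0; split => //.
  by rewrite mul0r scale0r !add0r polyC0.
have e0 : 0 <= e by have := p0 0%N; rewrite -cons_poly_def coef_cons.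
have [i|q [c [d [q0 c0 d0 ->]]]] := IH.
  by have := p0 i.+1; rewrite -cons_poly_def coef_cons.
(* Multiplication by X turns the remainder cX + d into c(X^2 - s) + dX + cs, and [s] is
   nonnegative. *)
exists (q * 'X + c%:P), d, (c * s + e); split => //.
- by move=> i; rewrite -cons_poly_def coef_cons; case: eqP.
- by rewrite addr_ge0// mulr_ge0.
- rewrite -!mul_polyC !polyCD !polyCM; ring.
Qed.

(* Pairing y i with - y i turns the product into a product of factors X^2 - s. *)
Lemma pos_divisor_symmetric (R : realFieldType) (r : R) (m : nat) (y : nat -> R) :
  0 <= r ->
  (forall i, (i < m)%N -> y (m.-1 - i)%N = - y i) ->
  (forall i, (i < m)%N -> `|y i| <= r) ->
  pos_divisor r (\prod_(0 <= i < m) ('X - (y i)%:P)).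
Proof.
move=> r0; have [k] := ubnP m; elim: k m y => // k IH [|[|m]] y mk ysym yr.
- rewrite big_nil; exact: pos_divisor1.
- rewrite big_nat1; have := ysym 0%N isT; rewrite subnn => y0.
  have -> : y 0%N = 0 by lra.
  by rewrite subr0; exact: pos_divisorX.
rewrite big_nat_recl// big_nat_recr//= mulrC -mulrA.
apply: pos_divisorM.
  apply: IH => [|i im|i im]; first by lia.
    have := ysym i.+1; rewrite /= => <-; last by lia.
    by congr y; lia.
  by apply: yr; lia.
have /= := ysym 0%N isT; rewrite subn0 => ->.
rewrite (_ : _ * _ = 'X^2 - (y 0%N ^+ 2)%:P); last first.
  by rewrite polyCN expr2 polyCM; ring.
apply: pos_divisor_sub_sqr => //; rewrite sqr_ge0/=.
by rewrite -real_normK ?num_real// lerXn2r// ?nnegrE// yr.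
Qed.

(** * Products of distances to equispaced points *)

Lemma deriv_prod (R : comNzRingType) (n : nat) (F : nat -> {poly R}) :
  (\prod_(i < n) F i)^`() =
  \sum_(i < n) (F i)^`() * \prod_(j < n | j != i) F j.
Proof.
elim: n => [|n IH]; first by rewrite !big_ord0 derivC.
rewrite big_ord_recr/= derivM IH big_ord_recr/= mulr_suml; congr (_ + _).
  apply: eq_bigr => i _; rewrite -mulrA; congr (_ * _).
  rewrite [in RHS]big_mkcond big_ord_recr/= -val_eqE/= gtn_eqF//.
  by rewrite [in LHS]big_mkcond; congr (_ * _); apply: eq_bigr.
rewrite mulrC; congr (_ * _).
rewrite [in RHS]big_mkcond big_ord_recr/= eqxx mulr1.
by apply: eq_bigr => i _; rewrite -val_eqE/= ltn_eqF.
Qed.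

Lemma prod_rev_succ (n : nat) : (\prod_(i < n) (n - i) = n`!)%N.
Proof.
elim: n => [|n IH]; first by rewrite big_ord0.
rewrite big_ord_recl/= subn0 factS; congr (_ * _)%N; rewrite -IH.
by apply: eq_bigr => i _; rewrite /bump/= add1n subSS.
Qed.

(** Induction, from [N] to N + 1. If [y <= N], the factor of the new point (or, when that one is
    omitted, of the point [N]) is at most N + 1, and the induction hypothesis bounds the rest.
    Otherwise [y] lies in the last unit interval, and the factors are compared with those of (N +
    1)!. *)
Lemma prod_dist_integers (R : realFieldType) (N : nat) (i : nat) (y : R) :
  0 <= y <= N%:R -> (i <= N)%N ->
  \prod_(l < N.+1 | (l : nat) != i) `|y - l%:R| <= N`!%:R.
Proof.
elim: N i => [|N IH] i /andP[y0 yN] iN.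
  rewrite big_pred0//; case: i iN => // _ [[|]]//.
have [yleN|/ltW Nley] := leP y N%:R.
  have hy : 0 <= y <= N%:R by rewrite y0.
  rewrite big_mkcond big_ord_recr/= -big_mkcond/= factS natrM mulrC.
  have [->|iN1] := eqVneq i N.+1.
    rewrite /= mul1r.
    rewrite (eq_bigl xpredT); last by move=> l /=; rewrite ltn_eqF.
    rewrite (bigD1 ord_max)//=; apply: ler_pM => //.
    - exact: prodr_ge0.
    - rewrite distrC ger0_norm ?subr_ge0//.
      rewrite -natr1; lra.
    by rewrite (le_trans _ (IH N hy _)).
  apply: ler_pM => //.
  - exact: prodr_ge0.
  - rewrite distrC ger0_norm ?subr_ge0//; lra.
  - by apply: IH => //; lia.
rewrite -prod_rev_succ natr_prod/=.
(* The maximum with 1 covers the last point, at distance at most 1 from [y]. As every factor is now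
   at least 1, the omitted one can be put back to complete the factorial. *)
apply: (@le_trans _ _ (\prod_(l < N.+2 | (l : nat) != i) (Num.max 1 (N.+1 - l)%:R : R))).
  apply: ler_prod => l _; rewrite normr_ge0/=.
  have [->|lN1] := eqVneq (l : nat) N.+1.
    rewrite distrC ger0_norm ?subr_ge0// le_max; apply/orP; left.
    move: Nley; rewrite -natr1; lra.
  have lN : (l <= N)%N by have := ltn_ord l; lia.
  rewrite le_max; apply/orP; right; rewrite ger0_norm ?subr_ge0.
    by rewrite natrB; [lra|lia].
  by rewrite (le_trans _ Nley)// ler_nat.
rewrite [leRHS](_ : _ = \prod_(l < N.+2) (Num.max 1 (N.+1 - l)%:R : R)); last first.
  rewrite [RHS]big_ord_recr/= subnn max_l// mulr1.
  apply: eq_bigr => l _; rewrite max_r// ler1n subn_gt0.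
  exact: ltn_ord.
rewrite [leRHS](bigID (fun l : 'I_N.+2 => (l : nat) != i))/=.
rewrite ler_peMr//.
  by apply: prodr_ge0 => l _; rewrite le_max ler01.
elim/big_ind: _ => // [u v u1 v1|l _]; last by rewrite le_max lexx.
nra.
Qed.

(** * Interpolation of cell averages on an equispaced grid *)

Definition node (R : realType) (N i : nat) : R := -1 + i%:R * Delta R N.

Lemma Delta_gt0 (R : realType) (N : nat) : (0 < N)%N -> 0 < Delta R N.
Proof. by move=> N0; rewrite divr_gt0 ?ltr0n. Qed.

Lemma mulN_Delta (R : realType) (N : nat) : (0 < N)%N -> N%:R * Delta R N = 2.
Proof. by move=> N0; rewrite mulrC divfK// pnatr_eq0 -lt0n. Qed.

Lemma node_inj (R : realType) (N : nat) : (0 < N)%N -> injective (node R N).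
Proof.
move=> /(Delta_gt0 R) D0 i j /addrI /(mulIf _) => /(_ (lt0r_neq0 D0)) /eqP.
by rewrite eqr_nat => /eqP.
Qed.

Lemma node_in (R : realType) (N i : nat) :
  (0 < N)%N -> (i <= N)%N -> -1 <= node R N i <= 1.
Proof.
move=> N0 iN; have D0 := Delta_gt0 R N0; have DN := mulN_Delta R N0.
have : (i%:R * Delta R N <= N%:R * Delta R N) by rewrite ler_pM2r// ler_nat.
have : 0 <= i%:R * Delta R N by rewrite mulr_ge0// ltW.
by rewrite /node DN => ? ?; apply/andP; split; lra.
Qed.

Lemma node_sym (R : realType) (N i : nat) :
  (0 < N)%N -> (i <= N)%N -> node R N (N - i) = - node R N i.
Proof.
move=> N0 iN; have DN := mulN_Delta R N0.
by rewrite /node natrB// mulrBl DN; lra.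
Qed.

Lemma eq0_at_nodes (R : realType) (N : nat) (p : {poly R}) :
  (0 < N)%N -> (size p <= N.+1)%N ->
  (forall i, (i <= N)%N -> p.[node R N i] = 0) -> p = 0.
Proof.
move=> N0 sp p0; apply: (@roots_geq_poly_eq0 _ _ (map (node R N) (iota 0 N.+1))).
- apply/allP => _ /mapP[i + ->]; rewrite mem_iota => /= iN.
  by apply/rootP/p0; lia.
- by rewrite (map_inj_uniq (node_inj N0)) iota_uniq.
- by rewrite size_map size_iota.
Qed.

(** Entry [b] becomes the coefficient of degree b + 1, so the constant term is 0. With this reading
    [VN] maps coefficients to increments over the cells, and its inversion becomes an interpolation
    problem. *)
Definition primitive_poly (R : realType) (N : nat) (u : 'cV[R]_N) : {poly R} :=
  \sum_(b < N) u b 0 *: 'X^(b.+1).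

Lemma size_primitive_poly (R : realType) (N : nat) (u : 'cV[R]_N) :
  (size (primitive_poly u) <= N.+1)%N.
Proof.
apply: (leq_trans (size_sum _ _ _)); apply/bigmax_leqP => b _.
apply: (leq_trans (size_scale_leq _ _)); rewrite size_polyXn.
by have := ltn_ord b; lia.
Qed.

Lemma coef_primitive_poly (R : realType) (N : nat) (u : 'cV[R]_N) (b : 'I_N) :
  (primitive_poly u)`_b.+1 = u b 0.
Proof.
rewrite coef_sum (bigD1 b)//= coefZ coefXn eqxx mulr1 big1 ?addr0// => i ib.
by rewrite coefZ coefXn eqSS eq_sym val_eqE (negbTE ib) mulr0.
Qed.

Lemma VN_mulmx_primitive (R : realType) (N : nat) (u : 'cV[R]_N) (a : 'I_N) :
  (VN R N *m u) a 0 =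
  (primitive_poly u).[node R N a.+1] - (primitive_poly u).[node R N a].
Proof.
rewrite mxE !horner_sum -sumrB; apply: eq_bigr => b _.
by rewrite mxE !hornerZ !hornerXn -mulrBr mulrC.
Qed.

Lemma primitive_poly_nodes (R : realType) (N : nat) (u : 'cV[R]_N) (F : nat -> R) :
  (forall a : 'I_N, (VN R N *m u) a 0 = F a.+1 - F a) ->
  forall i, (i <= N)%N ->
  (primitive_poly u).[node R N i] - (primitive_poly u).[node R N 0] = F i - F 0%N.
Proof.
move=> uF; elim=> [|i IH] iN; first by rewrite !subrr.
have := uF (Ordinal iN); rewrite VN_mulmx_primitive /= => h.
have := IH (ltnW iN); lra.
Qed.

(** A kernel vector gives a polynomial of degree at most N with the same value at all N + 1 nodes.
    It is therefore constant, and its coefficients of positive degree, which are the entries of the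
    vector, vanish. *)
Lemma VN_unit (R : realType) (N : nat) : (0 < N)%N -> VN R N \in unitmx.
Proof.
move=> N0; rewrite -unitmx_tr -row_free_unit; apply: inj_row_free => v vV.
have Vv : VN R N *m v^T = 0.
  by rewrite -[VN R N]trmxK -trmx_mul vV trmx0.
pose p := primitive_poly v^T.
have p0 : p - (p.[node R N 0])%:P = 0.
  apply: (eq0_at_nodes N0).
    rewrite (leq_trans (size_polyD _ _))// geq_max size_primitive_poly/=.
    by rewrite size_polyN (leq_trans (size_polyC_leq1 _)).
  move=> i iN; rewrite hornerD hornerN hornerC.
  rewrite (@primitive_poly_nodes _ _ _ (fun=> 0))// ?subrr// => a.
  by rewrite Vv mxE.
apply/rowP => b; rewrite !mxE.
have := coef_primitive_poly v^T b; rewrite mxE => <-.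
have /polyP/(_ b.+1) := p0; rewrite coefB coefC/= subr0 coef0; exact.
Qed.

(* [cell_moment N a j] is the integral of [t ^+ j] over the [a]-th cell. *)
Definition cell_moment (R : realType) (N a j : nat) : R :=
  (node R N a.+1 ^+ j.+1 - node R N a ^+ j.+1) / j.+1%:R.

Definition avg_coef (R : realType) (N j : nat) : 'cV[R]_N :=
  invmx (VN R N) *m \col_(a < N) cell_moment R N a j.

(* The polynomial of degree less than N having the same cell averages as t ^+ j. *)
Definition avg_interp (R : realType) (N j : nat) (x : R) : R :=
  \sum_(b < N) b.+1%:R * (\sum_(a < N) invmx (VN R N) b a * cell_moment R N a j)
    * x ^+ b.

(** The factor b + 1 in [avg_interp] is the one produced by differentiating X^(b+1). *)
Lemma avg_interpE (R : realType) (N j : nat) (x : R) :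
  avg_interp N j x = (primitive_poly (avg_coef R N j))^`().[x].
Proof.
rewrite raddf_sum horner_sum; apply: eq_bigr => b _ /=.
rewrite derivZ hornerZ derivXn hornerMn hornerXn mulrnAr -[RHS]mulr_natl mulrA.
congr (_ * _ * _).
by rewrite mxE; apply: eq_bigr => a _; rewrite mxE.
Qed.

Lemma VN_avg_coef (R : realType) (N j : nat) (a : 'I_N) : (0 < N)%N ->
  (VN R N *m avg_coef R N j) a 0 = cell_moment R N a j.
Proof.
by move=> N0; rewrite mulmxA mulmxV ?VN_unit// mul1mx mxE.
Qed.

(** For j < N the vector of cell moments is a column of [VN] divided by j + 1, so the inverse matrix
    returns a multiple of a unit vector. *)
Lemma avg_interp_exact (R : realType) (N j : nat) (x : R) :
  (j < N)%N -> avg_interp N j x = x ^+ j.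
Proof.
move=> jN; have N0 : (0 < N)%N by lia.
have uE : avg_coef R N j = \col_b (if b == Ordinal jN then j.+1%:R^-1 else 0).
  apply: (can_inj (mulKmx (VN_unit R N0))).
  apply/colP => a; rewrite VN_avg_coef// mxE (bigD1 (Ordinal jN))//= big1.
    by rewrite !mxE eqxx addr0.
  by move=> b bj; rewrite !mxE (negbTE bj) mulr0.
rewrite avg_interpE uE /primitive_poly (bigD1 (Ordinal jN))//= big1 ?addr0.
  rewrite mxE eqxx derivZ hornerZ derivXn hornerMn hornerXn mulrnAr.
  by rewrite -[LHS]mulr_natl mulrA mulfV ?mul1r// pnatr_eq0.
by move=> b bj; rewrite mxE (negbTE bj) scale0r.
Qed.

(** * The node polynomial and the growth of the interpolants *)

Definition node_poly (R : realType) (N : nat) : {poly R} :=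
  \prod_(0 <= i < N.+1) ('X - (node R N i)%:P).

Lemma node_poly_root (R : realType) (N i : nat) :
  (i <= N)%N -> (node_poly R N).[node R N i] = 0.
Proof.
move=> iN; rewrite /node_poly big_mkord horner_prod.
by rewrite (bigD1 (inord i))//= inordK ?hornerXsubC ?subrr ?mul0r.
Qed.

Lemma pos_divisor_node_poly (R : realType) (N : nat) (r : R) :
  (0 < N)%N -> 1 <= r -> pos_divisor r (node_poly R N).
Proof.
move=> N0 r1; apply: pos_divisor_symmetric => [|i iN|i iN].
- lra.
- exact: node_sym.
- by rewrite (le_trans _ r1)// ler_norml; apply: node_in.
Qed.

Lemma node_dist_le (R : realType) (N i : nat) (x : R) :
  (0 < N)%N -> (i <= N)%N -> `|x| <= 1 ->
  \prod_(l < N.+1 | (l : nat) != i) `|x - node R N l| <= N`!%:R * Delta R N ^+ N.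
Proof.
move=> N0 iN; rewrite ler_norml => /andP[x1 x2].
have D0 := Delta_gt0 R N0; have DN := mulN_Delta R N0.
(* The affine change of variable sends the nodes to the integers 0, ..., N; each of the N remaining
   factors contributes one [Delta]. *)
pose y := (x + 1) / Delta R N.
have xE l : x - node R N l = (y - l%:R) * Delta R N.
  by rewrite mulrBl /y divfK ?lt0r_neq0// /node; lra.
have y0N : 0 <= y <= N%:R.
  by rewrite divr_ge0 ?ler_pdivrMr//= ?DN; [lra|lra|exact: ltW].
rewrite (eq_bigr (fun l : 'I_N.+1 => `|y - l%:R| * Delta R N)); last first.
  by move=> l _; rewrite xE normrM (gtr0_norm D0).
rewrite big_split/= ler_pM//.
- exact: prodr_ge0.
- by apply: prodr_ge0 => l _; exact: ltW.
- exact: prod_dist_integers.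
rewrite prodr_const (_ : #|_| = N)//.
rewrite (eq_card (B := predC1 (inord i))); last first.
  by move=> l; rewrite !inE -val_eqE/= inordK.
by rewrite cardC1 card_ord.
Qed.

Lemma node_poly_le (R : realType) (N : nat) (x : R) :
  (0 < N)%N -> `|x| <= 1 -> `|(node_poly R N).[x]| <= 2 * (N`!%:R * Delta R N ^+ N).
Proof.
move=> N0 x1; rewrite /node_poly big_mkord horner_prod normr_prod.
rewrite (bigD1 ord0)//= ler_pM//.
- exact: prodr_ge0.
- rewrite hornerXsubC /node mul0r addr0; rewrite ler_norml in x1.
  by rewrite ler_norml; lra.
apply: le_trans (node_dist_le N0 (leq0n N) x1).
by apply: ler_prod => l _; rewrite normr_ge0 hornerXsubC/=.
Qed.

Lemma deriv_node_poly_le (R : realType) (N : nat) (x : R) :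
  (0 < N)%N -> `|x| <= 1 ->
  `|(node_poly R N)^`().[x]| <= N.+1%:R * (N`!%:R * Delta R N ^+ N).
Proof.
move=> N0 x1; rewrite /node_poly big_mkord (deriv_prod _ (fun i => 'X - (node R N i)%:P)).
rewrite horner_sum (le_trans (ler_norm_sum _ _ _))//.
rewrite [leRHS](_ : _ = \sum_(i < N.+1) (N`!%:R * Delta R N ^+ N)); last first.
  by rewrite sumr_const card_ord -[RHS]mulr_natl.
apply: ler_sum => i _; rewrite derivXsubC mul1r horner_prod normr_prod.
apply: le_trans (node_dist_le N0 (ltn_ord i : i <= N)%N x1).
rewrite (eq_bigl (fun l : 'I_N.+1 => (l : nat) != i))//.
by apply: ler_prod => l _; rewrite normr_ge0 hornerXsubC/=.
Qed.

(** The node 1 contributes the factor d exactly, and each node of index i < N a factor at least (N -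
    i) [Delta]; the latter multiply to N! [Delta]^N. *)
Lemma node_poly_ge (R : realType) (N : nat) (d : R) :
  (0 < N)%N -> 0 < d ->
  d * (N`!%:R * Delta R N ^+ N) <= (node_poly R N).[1 + d].
Proof.
move=> N0 d0; have D0 := Delta_gt0 R N0; have DN := mulN_Delta R N0.
rewrite /node_poly big_mkord horner_prod big_ord_recr/= mulrC.
rewrite ler_pM//.
- by rewrite mulr_ge0// exprn_ge0// ltW.
- exact: ltW.
- rewrite -prod_rev_succ natr_prod -[X in _ ^+ X](card_ord N) -prodr_const -big_split/=.
  apply: ler_prod => i _; rewrite mulr_ge0 ?(ltW D0)//=.
  rewrite hornerXsubC /node natrB ?mulrBl ?DN; last exact: ltnW.
  lra.
- by rewrite hornerXsubC /node DN; lra.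
Qed.

(** Differentiating the node polynomial costs a factor N + 1. Beyond the exact case one has j >= N,
    so the division by j + 1 absorbs it and the bound does not depend on N. *)
Lemma avg_interp_le (R : realType) (N j : nat) (d x : R) :
  (0 < N)%N -> 0 < d -> `|x| <= 1 ->
  `|avg_interp N j x| <= (1 + (1 + d) * (1 / d + 2 / d ^+ 2)) * (1 + d) ^+ j.
Proof.
move=> N0 d0 x1.
have rj1 : 1 <= (1 + d) ^+ j by rewrite exprn_ege1// lerDl ltW.
have K0 : 0 <= (1 + d) * (1 / d + 2 / d ^+ 2).
  have : 0 <= 1 / d by rewrite divr_ge0// ltW.
  have : 0 <= 2 / d ^+ 2 by rewrite divr_ge0// exprn_ge0// ltW.
  by move=> ? ?; rewrite mulr_ge0//; lra.
have xj1 : `|x ^+ j| <= 1 by rewrite normrX exprn_ile1.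
have [jN|Nj] := ltnP j N.
  by rewrite avg_interp_exact//; nra.
pose w := node_poly R N; pose M := N`!%:R * Delta R N ^+ N.
have M0 : 0 < M.
  by rewrite mulr_gt0 ?ltr0n ?fact_gt0// exprn_gt0// Delta_gt0.
(* Divide X^(j+1) by [w]: the remainder [s] agrees with X^(j+1) at the nodes, so it is the Lagrange
   interpolant. *)
have [|mw _ /(_ 'X^(j.+1))[]] := @pos_divisor_node_poly R N (1 + d) N0; first lra.
  by move=> i; rewrite coefXn.
move=> q [s [q0 XE sw]]; rewrite hornerXn => qw.
pose u := avg_coef R N j; pose p := primitive_poly u.
have size_w : size w = N.+2.
  by rewrite /w /node_poly size_prod_XsubC size_iota.
(* Both [s] and (j + 1) [p] have degree at most N and the same increments between nodes, hence they
   differ by a constant. *)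
have pE : s - j.+1%:R *: p - (s.[node R N 0] - j.+1%:R * p.[node R N 0])%:P = 0.
  apply: (eq0_at_nodes N0).
    rewrite (leq_trans (size_polyD _ _))// geq_max size_polyN.
    rewrite (leq_trans (size_polyC_leq1 _))// andbT.
    rewrite (leq_trans (size_polyD _ _))// geq_max size_polyN.
    rewrite (leq_trans (size_scale_leq _ _)) ?size_primitive_poly// andbT.
    by move: sw; rewrite size_w ltnS.
  move=> i iN.
  have sE k : (k <= N)%N -> s.[node R N k] = node R N k ^+ j.+1.
    move=> kN; rewrite -hornerXn XE hornerD hornerM node_poly_root//.
    by rewrite mulr0 add0r.
  have := @primitive_poly_nodes R N u (fun k => node R N k ^+ j.+1 / j.+1%:R) _ i iN.
  rewrite !(hornerD, hornerN, hornerZ, hornerC) !sE//.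
  move=> h; have {}h := h (fun a => etrans (VN_avg_coef R j a N0) (mulrBl _ _ _)).
  have -> : node R N i ^+ j.+1 - j.+1%:R * p.[node R N i] -
     (node R N 0 ^+ j.+1 - j.+1%:R * p.[node R N 0]) =
     (node R N i ^+ j.+1 - node R N 0 ^+ j.+1) -
     j.+1%:R * (p.[node R N i] - p.[node R N 0]) by ring.
  by rewrite h -mulrBl [j.+1%:R * _]mulrC divfK ?pnatr_eq0// subrr.
(* Differentiating X^(j+1) = q w + s removes that constant and leaves an error that involves only
   [q] and [w]. *)
have dE : j.+1%:R * avg_interp N j x =
    j.+1%:R * x ^+ j - (q^`().[x] * w.[x] + q.[x] * w^`().[x]).
  rewrite avg_interpE -/u -/p.
  have : (s - j.+1%:R *: p - (s.[node R N 0] - j.+1%:R * p.[node R N 0])%:P)^`().[x] = 0.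
    by rewrite pE derivC hornerC.
  rewrite !derivB derivZ derivC subr0 hornerD hornerN hornerZ => /eqP.
  rewrite subr_eq0 => /eqP <-.
  have <- : ('X^(j.+1) : {poly R})^`().[x] = j.+1%:R * x ^+ j.
    by rewrite derivXn hornerMn hornerXn mulr_natl.
  by rewrite XE derivD derivM !hornerD !hornerM; ring.
have wr : d * M <= w.[1 + d] by exact: node_poly_ge.
have qr0 : 0 <= q.[1 + d] by apply: nonneg_poly_horner => //; lra.
(* The product q(1 + d) M gets a bound free of N; this suffices, since the bounds on [w] and its
   derivative carry the same factor M. *)
have qr : q.[1 + d] * (d * M) <= (1 + d) ^+ j.+1.
  by apply: le_trans qw; rewrite ler_wpM2l.
have qx : `|q.[x]| <= q.[1 + d] by apply: nonneg_poly_horner_le => //; lra.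
have dqx : `|q^`().[x]| <= q.[1 + d] / d by exact: nonneg_poly_deriv_le.
have wx : `|w.[x]| <= 2 * M by exact: node_poly_le.
have dwx : `|w^`().[x]| <= N.+1%:R * M by exact: deriv_node_poly_le.
have Nj1 : N.+1%:R <= j.+1%:R :> R by rewrite ler_nat.
have j1 : 1 <= j.+1%:R :> R by rewrite ler1n.
have j0 : 0 < j.+1%:R :> R by rewrite ltr0n.
have qM : q.[1 + d] * M <= (1 + d) ^+ j.+1 / d by rewrite ler_pdivlMr//; lra.
have step : `|q^`().[x] * w.[x] + q.[x] * w^`().[x]| <=
    j.+1%:R * ((1 + d) ^+ j.+1 * (1 / d + 2 / d ^+ 2)).
  rewrite (le_trans (ler_normD _ _))// !normrM.
  have e1 : `|q^`().[x]| * `|w.[x]| <= (q.[1 + d] / d) * (2 * M) by apply: ler_pM.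
  have e2 : `|q.[x]| * `|w^`().[x]| <= q.[1 + d] * (N.+1%:R * M) by apply: ler_pM.
  have e3 : (q.[1 + d] / d) * (2 * M) <= j.+1%:R * ((1 + d) ^+ j.+1 * (2 / d ^+ 2)).
    rewrite (_ : _ / d * _ = (q.[1 + d] * M) * (2 / d)); last by ring.
    rewrite (_ : (1 + d) ^+ j.+1 * _ = ((1 + d) ^+ j.+1 / d) * (2 / d)); last first.
      by field; rewrite lt0r_neq0.
    have d2 : 0 <= 2 / d by rewrite divr_ge0// ltW.
    apply: (@le_trans _ _ ((1 + d) ^+ j.+1 / d * (2 / d))); first exact: ler_wpM2r.
    by rewrite ler_peMl// mulr_ge0// divr_ge0 ?exprn_ge0 ?(ltW d0)//; lra.
  have e4 : q.[1 + d] * (N.+1%:R * M) <= j.+1%:R * ((1 + d) ^+ j.+1 * (1 / d)).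
    rewrite mulrCA ler_pM// ?mul1r//.
    by rewrite mulr_ge0// ltW.
  by rewrite mulrDr; lra.
have h : j.+1%:R * `|avg_interp N j x| <=
    j.+1%:R * (1 + (1 + d) ^+ j.+1 * (1 / d + 2 / d ^+ 2)).
  have -> : j.+1%:R * `|avg_interp N j x| = `|j.+1%:R * avg_interp N j x|.
    by rewrite normrM (gtr0_norm j0).
  rewrite dE (le_trans (ler_normB _ _))// [leRHS]mulrDr lerD//.
  by rewrite normrM (gtr0_norm j0) ler_pM2l.
rewrite ler_pM2l// in h; apply: (le_trans h).
by rewrite [leRHS]mulrDl [1 * _ ^+ _]mul1r lerD// exprS le_eqVlt; apply/orP; left; apply/eqP; ring.
Qed.

(** * Iterated integrals *)

(** Tonelli's measurability of integrals of sections is applied to nonnegative functions on the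
    whole product, so [G] is extended by zero outside [D] and split into positive and negative
    parts. *)
Lemma measurable_integral_param d (T : measurableType d) (R : realType)
    (D : set R) (G : T * R -> \bar R) :
  measurable D -> measurable_fun [set: T * R] G ->
  measurable_fun [set: T] (fun s => \int[@lebesgue_measure R]_(x in D) G (s, x))%E.
Proof.
move=> mD mG; pose E := [set: T] `*` D.
have mE : measurable E by exact: measurableX.
have mH : measurable_fun [set: T * R] (G \_ E).
  by apply/(measurable_restrictT _ mE); exact: measurable_funTS.
have h (H : T * R -> \bar R) : measurable_fun [set: T * R] H ->
    (forall p, 0 <= H p)%E ->
    measurable_fun [set: T] (fun s => \int[@lebesgue_measure R]_x H (s, x))%E.
  move=> mH1 H0.
  exact: (measurable_fun_fubini_tonelli_F (m2 := @lebesgue_measure R) H mH1 H0).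
rewrite (_ : (fun s => _) = (fun s =>
    \int[@lebesgue_measure R]_x ((G \_ E)^\+ (s, x)) -
    \int[@lebesgue_measure R]_x ((G \_ E)^\- (s, x)))%E); last first.
  apply/funext => s; rewrite integral_mkcond integralE.
  have e x : ((fun x => G (s, x)) \_ D) x = (G \_ E) (s, x).
    by rewrite !patchE; congr (if _ then _ else _); rewrite /E in_setX in_setT.
  by congr (_ - _)%E; apply: eq_integral => x _; rewrite !(funeposE, funenegE) e.
apply: emeasurable_funB; apply: h => //.
- exact: measurable_funepos.
- exact: measurable_funeneg.
Qed.

Definition in_box (R : realType) (n : nat) (B : n.-tuple (R * R)) (x : n.-tuple R) : Prop :=
  forall k : 'I_n, (tnth B k).1 <= tnth x k <= (tnth B k).2.

Lemma in_box_cons (R : realType) (n : nat) (B : n.+1.-tuple (R * R)) (x : R)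
    (t : n.-tuple R) :
  (thead B).1 <= x <= (thead B).2 -> in_box [tuple of behead B] t ->
  in_box B [tuple of x :: t].
Proof.
move=> xB tB k; case: (unliftP ord0 k) => [j ->|->]; last by rewrite tnth0.
rewrite tnthS; have := tB j; rewrite tnth_behead.
by have -> : inord j.+1 = lift ord0 j by apply: val_inj; rewrite /= inordK// ltnS.
Qed.

Lemma iint_ext (R : realType) (n : nat) (B : n.-tuple (R * R))
    (F G : n.-tuple R -> \bar R) :
  (forall x, in_box B x -> F x = G x) -> iint F B = iint G B.
Proof.
elim: n B F G => [|n IH] B F G FG /=; first by apply: FG => -[].
apply: eq_integral => x; rewrite inE/= in_itv/= => xB.
by apply: IH => t tB; apply/FG/in_box_cons.
Qed.

Lemma iint_ge0 (R : realType) (n : nat) (B : n.-tuple (R * R))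
    (F : n.-tuple R -> \bar R) :
  (forall x, in_box B x -> 0 <= F x)%E -> (0 <= iint F B)%E.
Proof.
elim: n B F => [|n IH] B F F0 /=; first by apply: F0 => -[].
apply: integral_ge0 => x; rewrite /= in_itv/= => xB.
by apply: IH => t tB; apply/F0/in_box_cons.
Qed.

(** The parameter space [T] is arbitrary so that the induction can move the outer variable into it,
    passing from [T] to [T * R]. *)
Lemma measurable_iint_param d (T : measurableType d) (R : realType) (n : nat)
    (B : n.-tuple (R * R)) (F : T * n.-tuple R -> R) :
  measurable_fun [set: T * n.-tuple R] F ->
  measurable_fun [set: T] (fun s => iint (fun t => (F (s, t))%:E) B).
Proof.
elim: n d T B F => [|n IH] d T B F mF /=.
  apply/measurable_EFinP; apply: (measurableT_comp mF).
  by apply: measurable_fun_pair; [exact: measurable_id|exact: measurable_cst].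
pose G (p : T * R) := iint (fun t => (F (p.1, [tuple of p.2 :: t]))%:E)
   [tuple of behead B].
apply: (@measurable_integral_param _ _ _ _ G) => //.
apply: (IH _ _ _ (fun q : (T * R) * n.-tuple R => F (q.1.1, [tuple of q.1.2 :: q.2]))).
apply: (measurableT_comp mF); apply: measurable_fun_pair.
  exact: (measurableT_comp measurable_fst measurable_fst).
apply: measurable_cons; last exact: measurable_snd.
exact: (measurableT_comp measurable_snd measurable_fst).
Qed.

Lemma measurable_tuple_cons (R : realType) (n : nat) (F : n.+1.-tuple R -> R) (x : R) :
  measurable_fun [set: n.+1.-tuple R] F ->
  measurable_fun [set: n.-tuple R] (fun t : n.-tuple R => F [tuple of x :: t]).
Proof.
move=> mF; apply: (measurableT_comp mF); apply: measurable_cons.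
  exact: measurable_cst.
exact: measurable_id.
Qed.

Lemma measurable_iint_cons (R : realType) (n : nat) (B : n.-tuple (R * R))
    (F : n.+1.-tuple R -> R) :
  measurable_fun [set: n.+1.-tuple R] F ->
  measurable_fun [set: R] (fun x => iint (fun t => (F [tuple of x :: t])%:E) B).
Proof.
move=> mF; apply: (measurable_iint_param B (F := fun p : R * n.-tuple R => F [tuple of p.1 :: p.2])).
apply: (measurableT_comp mF); apply: measurable_cons.
  exact: measurable_fst.
exact: measurable_snd.
Qed.

Lemma iint_le (R : realType) (n : nat) (B : n.-tuple (R * R)) (F G : n.-tuple R -> R) :
  measurable_fun [set: n.-tuple R] F -> measurable_fun [set: n.-tuple R] G ->
  (forall x, in_box B x -> 0 <= F x <= G x) ->
  (iint (EFin \o F) B <= iint (EFin \o G) B)%E.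
Proof.
elim: n B F G => [|n IH] B F G mF mG FG /=.
  by rewrite lee_fin; have /andP[] : 0 <= F [tuple] <= G [tuple] by apply: FG => -[].
apply: ge0_le_integral => //=.
- move=> x; rewrite /= in_itv/= => xB.
  apply: iint_ge0 => t tB; rewrite lee_fin.
  by have /andP[] := FG _ (in_box_cons xB tB).
- by apply: measurable_funTS; exact: measurable_iint_cons mF.
- by apply: measurable_funTS; exact: measurable_iint_cons mG.
- move=> x; rewrite /= in_itv/= => xB.
  apply: IH; [exact: measurable_tuple_cons|exact: measurable_tuple_cons|].
  by move=> t tB; apply/FG/in_box_cons.
Qed.

Lemma abse_iint_le (R : realType) (n : nat) (B : n.-tuple (R * R)) (F : n.-tuple R -> R) :
  measurable_fun [set: n.-tuple R] F ->
  (`|iint (EFin \o F) B| <= iint (fun x => `|F x|%:E) B)%E.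
Proof.
elim: n B F => [|n IH] B F mF /=; first by [].
apply: le_trans (le_abse_integral _ _ _) _ => //.
  by apply: measurable_funTS; exact: measurable_iint_cons mF.
apply: ge0_le_integral => //=.
- apply: measurableT_comp => //.
  by apply: measurable_funTS; exact: measurable_iint_cons mF.
- apply: measurable_funTS; apply: (measurable_iint_cons _ (F := fun x => `|F x|)).
  exact: measurableT_comp.
- by move=> x _; apply: IH; exact: measurable_tuple_cons.
Qed.

Definition iintegrable (R : realType) (n : nat) (B : n.-tuple (R * R))
    (F : n.-tuple R -> R) : Prop :=
  measurable_fun [set: n.-tuple R] F /\ (iint (fun x => `|F x|%:E) B < +oo)%E.

Lemma iintegrable_fin_num (R : realType) (n : nat) (B : n.-tuple (R * R))
    (F : n.-tuple R -> R) :
  iintegrable B F -> iint (EFin \o F) B \is a fin_num.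
Proof.
move=> [mF iF]; rewrite fin_num_abs; apply: le_lt_trans iF.
exact: abse_iint_le.
Qed.

Lemma iintegrable_norm (R : realType) (n : nat) (B : n.-tuple (R * R))
    (F : n.-tuple R -> R) :
  iintegrable B F -> iintegrable B (fun x => `|F x|).
Proof.
move=> [mF iF]; split; first exact: measurableT_comp.
rewrite (@iint_ext _ _ _ _ (fun x => `|F x|%:E))// => x _.
by rewrite normr_id.
Qed.

Lemma integrable_iint_cons (R : realType) (n : nat) (B : n.+1.-tuple (R * R))
    (F : n.+1.-tuple R -> R) :
  iintegrable B F ->
  (@lebesgue_measure R).-integrable `[(thead B).1, (thead B).2]
    (fun x => iint (fun t => (F [tuple of x :: t])%:E) [tuple of behead B]).
Proof.
move=> [mF iF]; apply/integrableP; split.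
  by apply: measurable_funTS; exact: measurable_iint_cons mF.
apply: le_lt_trans iF; apply: ge0_le_integral => //=.
- apply: measurableT_comp => //.
  by apply: measurable_funTS; exact: measurable_iint_cons mF.
- apply: measurable_funTS; apply: (measurable_iint_cons _ (F := fun x => `|F x|)).
  exact: measurableT_comp.
- by move=> x _; apply: abse_iint_le; exact: measurable_tuple_cons.
Qed.

(** Induction on the dimension, by linearity of the outer integral. The slices of an integrable
    function are known to be integrable only for almost every first coordinate, so the two
    integrands are shown equal almost everywhere. *)
Lemma iint_linear (R : realType) (n : nat) (B : n.-tuple (R * R)) (k : R)
    (F G : n.-tuple R -> R) :
  iintegrable B F -> iintegrable B G ->
  (iint (fun x => (k * F x + G x)%:E) B =
   k%:E * iint (EFin \o F) B + iint (EFin \o G) B)%E.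
Proof.
elim: n B F G => [|n IH] B F G iF iG /=; first by rewrite EFinD EFinM.
have iF' := integrable_iint_cons iF; have iG' := integrable_iint_cons iG.
rewrite -integralZl// -integralD//; last exact: integrableZl.
apply: ae_eq_integral => //.
- apply: measurable_funTS; apply: (measurable_iint_cons _ (F := fun x => k * F x + G x)).
  by apply: measurable_funD iG.1; apply: measurable_funM iF.1; exact: measurable_cst.
- by apply: emeasurable_funD; apply/measurable_int; [exact: integrableZl iF'|exact: iG'].
have slice (H : n.+1.-tuple R -> R) x : iintegrable B H ->
    iint (fun t => `|H [tuple of x :: t]|%:E) [tuple of behead B] \is a fin_num ->
    iintegrable [tuple of behead B] (fun t => H [tuple of x :: t]).
  move=> [mH _] h; split; first exact: measurable_tuple_cons.
  by rewrite ltey_eq h.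
have aeF := integrable_ae _ (integrable_iint_cons (iintegrable_norm iF)).
have aeG := integrable_ae _ (integrable_iint_cons (iintegrable_norm iG)).
move: (aeF (measurable_itv _)) (aeG (measurable_itv _)).
apply: filterS2 => x hF hG xB.
exact: (IH _ _ _ (slice _ _ iF (hF xB)) (slice _ _ iG (hG xB))).
Qed.

Lemma iintegrable_linear (R : realType) (n : nat) (B : n.-tuple (R * R)) (k : R)
    (F G : n.-tuple R -> R) :
  iintegrable B F -> iintegrable B G -> iintegrable B (fun x => k * F x + G x).
Proof.
move=> iF iG; have mF := iF.1; have mG := iG.1.
have mkF (c : R) (H : n.-tuple R -> R) : measurable_fun [set: n.-tuple R] H ->
    measurable_fun [set: n.-tuple R] (fun x => c * H x).
  by move=> mH; apply: measurable_funM mH; exact: measurable_cst.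
split; first by apply: measurable_funD mG; exact: mkF.
have nF := iintegrable_norm iF; have nG := iintegrable_norm iG.
apply: (@le_lt_trans _ _ (iint (fun x => (`|k| * `|F x| + `|G x|)%:E) B)).
  apply: (@iint_le _ _ _ (fun x => `|k * F x + G x|) (fun x => `|k| * `|F x| + `|G x|)).
  - by apply: measurableT_comp => //; apply: measurable_funD mG; exact: mkF.
  - by apply: measurable_funD nG.1; apply: mkF; exact: nF.1.
  - by move=> x _; rewrite normr_ge0 -normrM ler_normD.
rewrite iint_linear// lte_add_pinfty//; last exact: iG.2.
by rewrite lte_mul_pinfty ?lee_fin//; exact: iF.2.
Qed.

(** * Bounded functions and monomials on boxes inside the cube *)

Definition volume (R : realType) (n : nat) (B : n.-tuple (R * R)) : R :=
  \prod_(k < n) ((tnth B k).2 - (tnth B k).1).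

(** Nondegenerate sides give the formulas for lengths and for integrals of powers; the bounds -1 and
    1 keep monomials at most 1 in absolute value. *)
Definition unit_box (R : realType) (n : nat) (B : n.-tuple (R * R)) : Prop :=
  forall k : 'I_n, [/\ -1 <= (tnth B k).1, (tnth B k).1 < (tnth B k).2
                     & (tnth B k).2 <= 1].

Lemma tnth_behead_lift (T : Type) (n : nat) (B : n.+1.-tuple T) (k : 'I_n) :
  tnth [tuple of behead B] k = tnth B (lift ord0 k).
Proof.
rewrite tnth_behead; congr tnth.
by apply: val_inj; rewrite /= inordK// ltnS.
Qed.

Lemma unit_box_behead (R : realType) (n : nat) (B : n.+1.-tuple (R * R)) :
  unit_box B -> unit_box [tuple of behead B].
Proof. by move=> uB k; rewrite tnth_behead_lift. Qed.

Lemma in_box_cube (R : realType) (n : nat) (B : n.-tuple (R * R)) (x : n.-tuple R) :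
  unit_box B -> in_box B x -> in_cube 1 x.
Proof.
move=> uB xB k; have [? ? ?] := uB k; have /andP[? ?] := xB k.
by rewrite ler_norml; lra.
Qed.

Lemma iint_cst (R : realType) (n : nat) (B : n.-tuple (R * R)) (K : R) :
  unit_box B -> iint (fun=> K%:E) B = (K * volume B)%:E.
Proof.
rewrite /volume; elim: n B => [|n IH] B uB /=; first by rewrite big_ord0 mulr1.
rewrite (eq_integral (cst (K * \prod_(k < n) ((tnth [tuple of behead B] k).2 -
  (tnth [tuple of behead B] k).1))%:E)); last first.
  by move=> x _; rewrite /= IH//; exact: unit_box_behead.
rewrite integral_cst//= lebesgue_measure_itv/= lte_fin.
have [_ -> _] := uB ord0; rewrite -EFinB -EFinM big_ord_recl mulrAC mulrA.
congr ((_ * _) %:E); apply: eq_bigr => i _.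
by rewrite tnth_behead_lift.
Qed.

Lemma iintegrable_bounded (R : realType) (n : nat) (B : n.-tuple (R * R))
    (F : n.-tuple R -> R) (K : R) :
  unit_box B -> measurable_fun [set: n.-tuple R] F ->
  (forall x, in_box B x -> `|F x| <= K) ->
  iintegrable B F /\ (`|iint (EFin \o F) B| <= (K * volume B)%:E)%E.
Proof.
move=> uB mF FK.
have h : (iint (fun x => `|F x|%:E) B <= (K * volume B)%:E)%E.
  rewrite -iint_cst//; apply: (@iint_le _ _ _ (fun x => `|F x|) (fun=> K)).
  - exact: measurableT_comp.
  - exact: measurable_cst.
  - by move=> x /FK ->; rewrite normr_ge0.
split; first by split=> //; apply: le_lt_trans h _; rewrite ltry.
exact: le_trans (abse_iint_le _ mF) h.
Qed.

Lemma measurable_mono (R : realType) (n : nat) (be : 'I_n -> nat) :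
  measurable_fun [set: n.-tuple R] (fun x => mono x be).
Proof.
apply: measurable_prod => k _; apply: measurable_funX.
exact: measurable_tnth.
Qed.

Lemma mono_le (R : realType) (n : nat) (be : 'I_n -> nat) (r : R) (x : n.-tuple R) :
  in_cube r x -> `|mono x be| <= \prod_(k < n) r ^+ be k.
Proof.
move=> xr; rewrite normr_prod; apply: ler_prod => k _; rewrite normr_ge0/= normrX.
by apply: lerXn2r; rewrite ?nnegrE// (le_trans _ (xr k)).
Qed.

Lemma iintegrable_mono (R : realType) (n : nat) (B : n.-tuple (R * R)) (be : 'I_n -> nat) :
  unit_box B -> iintegrable B (fun x => mono x be).
Proof.
move=> uB; apply: (proj1 (@iintegrable_bounded _ _ _ _ 1 uB (measurable_mono _) _)).
move=> x /(in_box_cube uB) xB; rewrite (le_trans (mono_le _ xB))//.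
by rewrite big1// => k _; rewrite expr1n.
Qed.

Lemma iintegrable_cst (R : realType) (n : nat) (B : n.-tuple (R * R)) (K : R) :
  unit_box B -> iintegrable B (fun=> K).
Proof.
by move=> uB; apply: (proj1 (@iintegrable_bounded _ _ _ _ `|K| uB _ _)).
Qed.

Lemma integral_power (R : realType) (l u c : R) (j : nat) : l < u ->
  (\int[@lebesgue_measure R]_(x in `[l, u]) (c * x ^+ j)%:E)%E =
  (c * ((u ^+ j.+1 - l ^+ j.+1) / j.+1%:R))%:E.
Proof.
move=> lu; pose P : {poly R} := (c / j.+1%:R) *: 'X^(j.+1).
have dP x : P^`().[x] = c * x ^+ j.
  rewrite derivZ hornerZ derivXn hornerMn hornerXn mulrnAr -mulrnAl.
  by rewrite -[_ *+ _]mulr_natr divfK// pnatr_eq0.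
rewrite (@continuous_FTC2 _ _ (horner P))//.
- rewrite !hornerZ !hornerXn -EFinB; congr (_ %:E); ring.
- apply: continuous_subspaceT => x.
  rewrite (_ : (fun y => c * y ^+ j) = horner P^`()); last by apply/funext => y; rewrite dP.
  exact: continuous_horner.
- split=> [x _| |].
  + exact: derivable_horner.
  + by apply: cvg_at_right_filter; exact: continuous_horner.
  + by apply: cvg_at_left_filter; exact: continuous_horner.
- by move=> x _; rewrite -derivE dP.
Qed.

Lemma mono_cons (R : realType) (n : nat) (be : 'I_n.+1 -> nat) (x : R) (t : n.-tuple R) :
  mono [tuple of x :: t] be = x ^+ be ord0 * mono t (fun k => be (lift ord0 k)).
Proof.
rewrite /mono big_ord_recl tnth0; congr (_ * _).
by apply: eq_bigr => k _; rewrite tnthS.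
Qed.

Lemma iint_mono (R : realType) (n : nat) (B : n.-tuple (R * R)) (be : 'I_n -> nat) :
  unit_box B ->
  iint (fun x => (mono x be)%:E) B =
  (\prod_(k < n) (((tnth B k).2 ^+ (be k).+1 - (tnth B k).1 ^+ (be k).+1)
                   / (be k).+1%:R))%:E.
Proof.
elim: n B be => [|n IH] B be uB /=; first by rewrite /mono !big_ord0.
set c := \prod_(k < n) (((tnth B (lift ord0 k)).2 ^+ (be (lift ord0 k)).+1 -
  (tnth B (lift ord0 k)).1 ^+ (be (lift ord0 k)).+1) / (be (lift ord0 k)).+1%:R).
have uB' := unit_box_behead uB.
have E x : iint (fun t => (mono [tuple of x :: t] be)%:E) [tuple of behead B] =
    (c * x ^+ be ord0)%:E.
  (* Linearity with the zero function as second summand pulls the power of [x] out of the inner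
     integral. *)
  have := @iint_linear R n [tuple of behead B] (x ^+ be ord0)
    (fun t => mono t (fun k => be (lift ord0 k))) (fun=> 0)
    (iintegrable_mono _ uB') (iintegrable_cst _ uB').
  rewrite (iint_cst 0)// mul0r adde0 IH// => e.
  rewrite [c * _]mulrC EFinM (_ : c%:E = (\prod_(k < n)
      (((tnth [tuple of behead B] k).2 ^+ (be (lift ord0 k)).+1 -
        (tnth [tuple of behead B] k).1 ^+ (be (lift ord0 k)).+1)
       / (be (lift ord0 k)).+1%:R))%:E); last first.
    by congr (_ %:E); apply: eq_bigr => k _; rewrite tnth_behead_lift.
  rewrite -e; apply: iint_ext => t _.
  by rewrite mono_cons addr0.
have [_ lu _] := uB ord0.
transitivity (\int[@lebesgue_measure R]_(x in `[(thead B).1, (thead B).2])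
    (c * x ^+ be ord0)%:E)%E; first by apply: eq_integral => x _; rewrite E.
by rewrite integral_power// big_ord_recl mulrC.
Qed.

Lemma iintegrable_sum (R : realType) (n : nat) (B : n.-tuple (R * R)) (I : Type)
    (s : seq I) (c : I -> R) (F : I -> n.-tuple R -> R) :
  unit_box B -> (forall i, iintegrable B (F i)) ->
  iintegrable B (fun x => \sum_(i <- s) c i * F i x) /\
  iint (fun x => (\sum_(i <- s) c i * F i x)%:E) B =
  (\sum_(i <- s) (c i)%:E * iint (EFin \o F i) B)%E.
Proof.
move=> uB iF; elim: s => [|i s [IH1 IH2]].
  have e : (fun x : n.-tuple R => \sum_(i <- [::]) c i * F i x) = (fun=> 0).
    by apply/funext => x; rewrite big_nil.
  rewrite e; split; first exact: iintegrable_cst.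
  transitivity (iint (fun=> 0%:E) B); last by rewrite iint_cst// mul0r big_nil.
  by apply: iint_ext => x _; rewrite big_nil.
have e : (fun x : n.-tuple R => \sum_(i <- i :: s) c i * F i x) =
    (fun x => c i * F i x + \sum_(i <- s) c i * F i x).
  by apply/funext => x; rewrite big_cons.
rewrite e; split; first exact: iintegrable_linear.
rewrite big_cons -IH2 -iint_linear//.
by apply: iint_ext => x _; rewrite big_cons.
Qed.

(** * Sign change of f at the implicit function *)

Section sign_change.
Context {R : realType} {n : nat} (f : n.-tuple R -> R -> R) (a b : R) (x : n.-tuple R).
Context (x1 : in_cube 1 x) (cf : cont_on f a b).

Lemma cvg_sgnR_within (y0 : R) :
  (exists2 d, 0 < d & forall y, a <= y <= b -> `|y - y0| < d ->
     sgnR (f x y) = sgnR (f x y0)) ->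
  (fun y => sgnR (f x y)) @ within `[a, b] (nbhs y0) --> sgnR (f x y0).
Proof.
move=> [d d0 h]; apply: cvg_near_cst; apply/nbhs_ballP; exists d => //= y yd yab.
apply: h; first by move: yab; rewrite /= in_itv.
by move: yd; rewrite /ball/= distrC.
Qed.

(** Continuity of [f], taken with tolerance |f(x,y0)|, keeps the sign constant near a point that is
    not a root. *)
Lemma sgnR_discontinuity_root (y0 : R) : a <= y0 <= b ->
  ~ ((fun y => sgnR (f x y)) @ within `[a, b] (nbhs y0) --> sgnR (f x y0)) ->
  f x y0 = 0.
Proof.
move=> y0ab disc; apply: contrapT => /eqP fy0; apply: disc.
have e0 : 0 < `|f x y0| by rewrite normr_gt0.
have [d d0 h] := cf x1 y0ab e0; apply: cvg_sgnR_within; exists d => // y yab yd.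
have {h} := h x y x1 yab _ yd.
have h0 : forall k : 'I_n, `|tnth x k - tnth x k| < d by move=> k; rewrite subrr normr0.
move=> /(_ h0); rewrite /sgnR.
case: (leP 0 (f x y0)) => fy; case: (leP 0 (f x y)) => fy' //; rewrite ltr_norml;
  move: fy0; [rewrite ger0_norm// => ? /andP[? ?]|rewrite ltr0_norm// => ? /andP[? ?]]; lra.
Qed.

(** The discontinuity of the sign is a root, hence equal to [gx]. As the sign of 0 is 1,
    nonnegativity of [f] around [gx] would make the sign locally constant there. *)
Lemma sign_change_at_root (gx : R) :
  (exists! y0 : R, a <= y0 <= b /\
      ~ ((fun y => sgnR (f x y)) @ within `[a, b] (nbhs y0) --> sgnR (f x y0))) ->
  a <= gx <= b -> f x gx = 0 ->
  (forall y, a <= y <= b -> f x y = 0 -> y = gx) ->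
  ~ (exists2 d, 0 < d & forall y, a <= y <= b -> `|y - gx| < d -> 0 <= f x y).
Proof.
move=> [y0 [[y0ab disc] _]] gab fg uniq [d d0 h].
have y0g : y0 = gx by apply: uniq => //; exact: sgnR_discontinuity_root.
apply: disc; apply: cvg_sgnR_within; exists d => // y yab; rewrite y0g => yd.
by rewrite /sgnR fg lexx h.
Qed.

(** By monotonicity of the sign, [f] is nonnegative exactly on [gx, b] when [ny] is 1 and on [a, gx]
    when it is -1; the right-hand side writes both lengths in one formula. *)
Lemma ThetaR_integral (ny gx : R) :
  a < b ->
  (exists! y0 : R, a <= y0 <= b /\
      ~ ((fun y => sgnR (f x y)) @ within `[a, b] (nbhs y0) --> sgnR (f x y0))) ->
  ny_spec f a b ny ->
  a <= gx <= b -> f x gx = 0 ->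
  (forall y, a <= y <= b -> f x y = 0 -> y = gx) ->
  (\int[@lebesgue_measure R]_(y in `[a, b]) (ThetaR (f x y))%:E)%E =
  ((1 + ny) / 2 * b - (1 - ny) / 2 * a - ny * gx)%:E.
Proof.
move=> ab assum nyE gab fg uniq; have nc := sign_change_at_root assum gab fg uniq.
have /andP[ag gb] := gab.
have sgn_le y1 y2 : sgnR (f x y1) <= sgnR (f x y2) -> 0 <= f x y1 -> 0 <= f x y2.
  by rewrite /sgnR => + h; rewrite h; case: ifP => //; lra.
have indic_int (l u : R) : a <= l -> l <= u -> u <= b ->
    (forall y, a <= y <= b -> (0 <= f x y) = (l <= y <= u)) ->
    (\int[@lebesgue_measure R]_(y in `[a, b]) (ThetaR (f x y))%:E)%E = (u - l)%:E.
  move=> al lu ub h.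
  transitivity (\int[@lebesgue_measure R]_(y in `[a, b]) (\1_(`[l, u]%classic : set R) y)%:E)%E.
    apply: eq_integral => y; rewrite inE/= in_itv/= => yab; congr (_ %:E).
    by rewrite /ThetaR h// indicE mem_setE in_itv/=; case: ifP.
  rewrite integral_indic//= setIidl; last first.
    by move=> y; rewrite /= !in_itv/= => /andP[? ?]; apply/andP; split; lra.
  rewrite lebesgue_measure_itv/= lte_fin; case: ltP => [//|ul].
  by congr (_ %:E); lra.
case: nyE => [[-> incr]|[-> decr]].
  rewrite (indic_int gx b)//; first by congr (_ %:E); lra.
  move=> y yab; have /andP[ya yb] := yab; rewrite yb andbT; apply/idP/idP; last first.
    by move=> gy; apply: sgn_le (incr _ x1 _ _ ag gy yb) _; rewrite fg.
  (* Nonnegativity of [f] at some [y < gx] would spread by monotonicity to a neighbourhood of [gx],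
     against [nc]. *)
  move=> fy; rewrite leNgt; apply/negP => yg; apply: nc.
  exists (gx - y); first by rewrite subr_gt0.
  move=> z /andP[za zb] zd; apply: sgn_le (incr x x1 y z ya _ zb) fy.
  by move: zd; rewrite ltr_norml => /andP[? ?]; lra.
rewrite (indic_int a gx)//; first by congr (_ %:E); lra.
move=> y yab; have /andP[ya yb] := yab; rewrite ya andTb; apply/idP/idP; last first.
  by move=> gy; apply: sgn_le (decr _ x1 _ _ ya gy gb) _; rewrite fg.
move=> fy; rewrite leNgt; apply/negP => yg; apply: nc.
exists (y - gx); first by rewrite subr_gt0.
move=> z /andP[za zb] zd; apply: sgn_le (decr x x1 z y za _ yb) fy.
by move: zd; rewrite ltr_norml => /andP[? ?]; lra.
Qed.

End sign_change.

(** * Convergence *)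

(** Index functions with codomains ['I_N.+1] and ['I_M.+1] are matched through [inord], so that
    partial sums of different orders can be subtracted. *)
Lemma sum_ffun_widen (R : realType) (n N M : nat) (F : ('I_n -> nat) -> R) :
  (N <= M)%N ->
  \sum_(be : {ffun 'I_n -> 'I_M.+1} | [forall k, (be k <= N)%N]) F (fun k => val (be k)) =
  \sum_(be : {ffun 'I_n -> 'I_N.+1}) F (fun k => val (be k)).
Proof.
move=> NM.
pose h (be : {ffun 'I_n -> 'I_N.+1}) : {ffun 'I_n -> 'I_M.+1} :=
  [ffun k => inord (be k)].
pose h' (be : {ffun 'I_n -> 'I_M.+1}) : {ffun 'I_n -> 'I_N.+1} :=
  [ffun k => inord (be k)].
have hE be k : h be k = be k :> nat.
  by rewrite ffunE inordK//; have := ltn_ord (be k); lia.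
rewrite (reindex h)/=; last first.
  exists h' => [be _|be].
    by apply/ffunP => k; apply: val_inj; rewrite ffunE hE inord_val.
  rewrite inE => /forallP beN; apply/ffunP => k; apply: val_inj.
  by rewrite /= hE ffunE inordK// ltnS.
apply: eq_big => [be|be _].
  by apply/forallP => k; rewrite hE -ltnS.
by congr F; apply/funext => k; rewrite /= hE.
Qed.

Definition psum (R : realType) (n : nat) (F : ('I_n -> nat) -> R) (M : nat) : R :=
  \sum_(be : {ffun 'I_n -> 'I_M.+1}) F (fun k => val (be k)).

(** Both differences run over the multi-indices with some entry beyond N, where the terms are
    compared one by one. *)
Lemma psum_diff_le (R : realType) (n N M : nat) (F W : ('I_n -> nat) -> R) :
  (N <= M)%N -> (forall be, `|F be| <= W be) ->
  `|psum F M - psum F N| <= psum W M - psum W N.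
Proof.
move=> NM FW.
have diffE (G : ('I_n -> nat) -> R) : psum G M - psum G N =
    \sum_(be : {ffun 'I_n -> 'I_M.+1} | ~~ [forall k, (be k <= N)%N])
       G (fun k => val (be k)).
  rewrite /psum -(sum_ffun_widen G NM).
  apply/eqP; rewrite subr_eq addrC; apply/eqP.
  by rewrite (bigID (fun be : {ffun 'I_n -> 'I_M.+1} => [forall k, (be k <= N)%N])).
by rewrite !diffE (le_trans (ler_norm_sum _ _ _))// ler_sum.
Qed.

Lemma dist_lim_le (R : realType) (u : nat -> R) (l v e : R) (N : nat) :
  u @ \oo --> l -> (forall M, (N <= M)%N -> `|u M - v| <= e) -> `|l - v| <= e.
Proof.
move=> ul h; apply/ler_addgt0Pr => t t0.
move/cvgrPdist_le : ul => /(_ t t0) ul.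
near \oo => M.
have h1 : `|l - u M| <= t by near: M.
have h2 : `|u M - v| <= e by apply: h; near: M; exact: nbhs_infty_ge.
rewrite (_ : l - v = (u M - v) + (l - u M)); last by ring.
by rewrite (le_trans (ler_normD _ _))// lerD.
Unshelve. all: end_near. Qed.

Lemma cvg_sumr (R : realType) (I : Type) (s : seq I) (u : I -> nat -> R) (l : I -> R) :
  (forall i, u i @ \oo --> l i) ->
  (fun M => \sum_(i <- s) u i M) @ \oo --> \sum_(i <- s) l i.
Proof.
move=> ul; elim: s => [|i s IH].
  rewrite big_nil (_ : (fun=> _) = fun=> 0); first exact: cvg_cst.
  by apply/funext => M; rewrite big_nil.
rewrite big_cons (_ : (fun M => _) = fun M => u i M + \sum_(j <- s) u j M).
  exact: cvgD (ul i) IH.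
by apply/funext => M; rewrite big_cons.
Qed.

(** * The operator from cell data to polynomials *)

Section averages.
Context {R : realType} {n : nat} (N : nat) (x : n.-tuple R).

(** This is [gtilde] with the coefficients [dcoef] replaced by arbitrary cell data [D], on which it
    depends linearly. *)
Definition avg_op (D : {ffun 'I_n -> 'I_N} -> R) : R :=
  \sum_(be : {ffun 'I_n -> 'I_N}) (\prod_(k < n) (be k).+1%:R) *
    (\sum_(al : {ffun 'I_n -> 'I_N}) (\prod_(k < n) invmx (VN R N) (be k) (al k)) * D al)
    * mono x (fun k => val (be k)).

Lemma avg_op_sum (I : finType) (c : I -> R) (D : I -> {ffun 'I_n -> 'I_N} -> R) :
  avg_op (fun al => \sum_i c i * D i al) = \sum_i c i * avg_op (D i).
Proof.
under [RHS]eq_bigr do rewrite mulr_sumr.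
rewrite exchange_big/=; apply: eq_bigr => be _.
transitivity ((\prod_(k < n) (be k).+1%:R) *
   (\sum_i c i * \sum_(al : {ffun 'I_n -> 'I_N})
      (\prod_(k < n) invmx (VN R N) (be k) (al k)) * D i al)
   * mono x (fun k => val (be k))).
  congr (_ * _ * _); under [RHS]eq_bigr do rewrite mulr_sumr.
  rewrite exchange_big/=; apply: eq_bigr => al _.
  by rewrite mulr_sumr; apply: eq_bigr => i _; ring.
by rewrite mulr_sumr mulr_suml; apply: eq_bigr => i _; ring.
Qed.

(** Distributivity turns the sums over multi-indices into products of one-variable sums. *)
Lemma avg_op_prod (m : 'I_n -> nat) :
  avg_op (fun al => \prod_(k < n) cell_moment R N (al k) (m k)) =
  \prod_(k < n) avg_interp N (m k) (tnth x k).
Proof.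
rewrite /avg_interp bigA_distr_bigA/=; apply: eq_bigr => be _.
rewrite /mono !big_split/=; congr (_ * _ * _).
rewrite bigA_distr_bigA/=; apply: eq_bigr => al _.
by rewrite [RHS]big_split.
Qed.

Lemma cvg_avg_op (D : nat -> {ffun 'I_n -> 'I_N} -> R) (E : {ffun 'I_n -> 'I_N} -> R) :
  (forall al, D ^~ al @ \oo --> E al) -> (fun M => avg_op (D M)) @ \oo --> avg_op E.
Proof.
move=> DE; apply: cvg_sumr => be; apply: cvgM; last exact: cvg_cst.
apply: cvgM; first exact: cvg_cst.
by apply: cvg_sumr => al; apply: cvgM; [exact: cvg_cst|exact: DE].
Qed.

End averages.

Lemma iintegrable_mul_bounded (R : realType) (n : nat) (B : n.-tuple (R * R))
    (h phi : n.-tuple R -> R) (K : R) :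
  measurable_fun [set: n.-tuple R] h -> iintegrable B phi -> 0 <= K ->
  (forall x, in_box B x -> `|h x| <= K) ->
  iintegrable B (fun x => h x * phi x) /\
  (`|iint (fun x => (h x * phi x)%:E) B| <= K%:E * iint (fun x => `|phi x|%:E) B)%E.
Proof.
move=> mh iphi K0 hK.
have mhphi : measurable_fun [set: n.-tuple R] (fun x => h x * phi x).
  by apply: measurable_funM mh iphi.1.
have [mn _] := iintegrable_norm iphi.
have le : (iint (fun x => `|h x * phi x|%:E) B <= K%:E * iint (fun x => `|phi x|%:E) B)%E.
  (* For a general box [B], integrability of 0 comes from comparison with [phi]; linearity then
     gives its integral as -z + z with z finite. *)
  have i0 : iintegrable B (fun=> 0).
    split; first exact: measurable_cst.
    apply: le_lt_trans iphi.2; apply: (@iint_le _ _ _ (fun=> `|0|) (fun x => `|phi x|)) => //.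
    by move=> x _; rewrite normr0 lexx normr_ge0.
  have z : iint (fun=> 0%:E) B = 0%E.
    have := iint_linear (-1) i0 i0.
    rewrite /comp (@iint_ext _ _ _ _ (fun=> 0%:E)); last by move=> x _; rewrite mulr0 addr0.
    move=> ->; rewrite -(fineK (iintegrable_fin_num i0)) -EFinM -EFinD.
    by rewrite mulN1r addNr.
  have <- : iint (fun x => (K * `|phi x| + 0)%:E) B =
      (K%:E * iint (fun x => `|phi x|%:E) B)%E.
    by rewrite (iint_linear K (iintegrable_norm iphi) i0) /comp z adde0.
  apply: (@iint_le _ _ _ (fun x => `|h x * phi x|) (fun x => K * `|phi x| + 0)).
  - exact: measurableT_comp.
  - by apply: measurable_funD; [apply: measurable_funM => //|]; exact: measurable_cst.
  - by move=> x /hK hx; rewrite normr_ge0/= addr0 normrM ler_wpM2r.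
split; last exact: le_trans (abse_iint_le _ mhphi) le.
split=> //; apply: (le_lt_trans le).
by rewrite lte_mul_pinfty ?lee_fin//; exact: iphi.2.
Qed.

Lemma in_box_cubeE (R : realType) (n : nat) (x : n.-tuple R) :
  in_box (cube R n) x <-> in_cube 1 x.
Proof.
split=> h k; have := h k; rewrite tnth_mktuple/= ler_norml//.
Qed.

Lemma unit_box_Rbox (R : realType) (n N : nat) (al : {ffun 'I_n -> 'I_N}) :
  (0 < N)%N -> unit_box (Rbox R al).
Proof.
move=> N0 k; rewrite tnth_mktuple/=; split.
- by have /andP[] := node_in R N0 (ltnW (ltn_ord (al k))).
- by rewrite ltrD2l ltr_pM2r ?Delta_gt0// ltr_nat.
- by have /andP[] := node_in R N0 (ltn_ord (al k)).
Qed.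

Lemma volume_Rbox (R : realType) (n N : nat) (al : {ffun 'I_n -> 'I_N}) :
  volume (Rbox R al) = Delta R N ^+ n.
Proof.
rewrite /volume -[n in RHS]card_ord -prodr_const; apply: eq_bigr => k _.
by rewrite tnth_mktuple/= -natr1; ring.
Qed.

Lemma measurable_ps_partial (R : realType) (n : nat) (c : ('I_n -> nat) -> R) (M : nat) :
  measurable_fun [set: n.-tuple R] (fun x => ps_partial c x M).
Proof.
apply: measurable_sum => be; apply: measurable_funM; first exact: measurable_cst.
exact: measurable_mono.
Qed.

Lemma measurable_gtilde (R : realType) (n N : nat) (f : n.-tuple R -> R -> R) (a b ny : R) :
  measurable_fun [set: n.-tuple R] (gtilde N f a b ny).
Proof.
apply: measurable_sum => be; apply: measurable_funM; first exact: measurable_cst.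
exact: measurable_mono.
Qed.

(* The function [g] is arbitrary outside the cube; this extension by zero is measurable. *)
Lemma measurable_extension (R : realType) (n : nat) (c : ('I_n -> nat) -> R)
    (g : n.-tuple R -> R) :
  (forall x, in_cube 1 x -> ps_partial c x M @[M --> \oo] --> g x) ->
  exists2 gb : n.-tuple R -> R, measurable_fun [set: n.-tuple R] gb &
    forall x, in_cube 1 x -> gb x = g x.
Proof.
move=> cg.
pose chi (x : n.-tuple R) : R := \prod_(k < n) \1_(`[-1, 1]%classic : set R) (tnth x k).
have chi1 x : in_cube 1 x -> chi x = 1.
  move=> xc; rewrite /chi big1// => k _; rewrite indicE mem_set//= in_itv/=.
  by rewrite -ler_norml.
have chi0 x : ~ in_cube 1 x -> chi x = 0.
  move=> xc; have [k xk] : exists k : 'I_n, ~~ (`|tnth x k| <= 1).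
    by apply: contrapT => h; apply: xc => k; apply: contrapT => /negP hk; apply: h; exists k.
  rewrite /chi (bigD1 k)//= indicE memNset ?mul0r//= in_itv/= -ler_norml.
  exact/negP.
exists (fun x => g x * chi x); last by move=> x xc; rewrite chi1// mulr1.
(* Multiplied by [chi], the partial sums converge at every point, to 0 outside the cube, so the
   limit is measurable. *)
apply: (@measurable_fun_cvg _ _ _ _ (fun M x => ps_partial c x M * chi x)).
  move=> M; apply: measurable_funM; first exact: measurable_ps_partial.
  apply: measurable_prod => k _.
  have m1 : measurable_fun [set: R] (\1_(`[-1, 1]%classic : set R) : R -> R).
    by apply: measurable_indic; exact: measurable_itv.
  exact: (measurableT_comp m1 (measurable_tnth k)).
move=> x _; have [xc|xc] := pselect (in_cube 1 x).
  by apply: cvgM; [exact: cg|exact: cvg_cst].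
rewrite chi0// mulr0 (_ : (fun=> _) = fun=> 0); first exact: cvg_cst.
by apply/funext => M; rewrite mulr0.
Qed.

Lemma ps_tail (R : realType) (n : nat) (W : ('I_n -> nat) -> R) (B0 : R) :
  (forall be, 0 <= W be) -> (forall M, psum W M <= B0) ->
  exists2 S : R, psum W @ \oo --> S & forall M, psum W M <= S.
Proof.
move=> W0 WB.
have nd : nondecreasing_seq (psum W).
  move=> N M NM; have := @psum_diff_le _ _ N M (fun=> 0) W NM.
  move=> /(_ (fun be => _)) h.
  have {h} : 0 <= psum W M - psum W N.
    by apply: le_trans (normr_ge0 _) (h _) => be; rewrite normr0.
  by rewrite subr_ge0.
have cv : cvgn (psum W).
  by apply: nondecreasing_is_cvgn => //; exists B0 => _ [M _ <-].
exists (limn (psum W)) => //.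
exact: nondecreasing_cvgn_le.
Qed.

(** Integrating the formula for [ThetaR] over the cell gives -[ny] times the integral of [g] plus a
    constant; in [dcoef] the constants cancel because [ny] squares to 1. *)
Lemma dcoef_integral (R : realType) (n N : nat) (f : n.-tuple R -> R -> R)
    (a b ny : R) (g : n.-tuple R -> R) (al : {ffun 'I_n -> 'I_N}) :
  (0 < N)%N -> a < b -> ny = 1 \/ ny = -1 ->
  iintegrable (Rbox R al) g ->
  (forall x, in_cube 1 x ->
    (\int[@lebesgue_measure R]_(y in `[a, b]) (ThetaR (f x y))%:E)%E =
    ((1 + ny) / 2 * b - (1 - ny) / 2 * a - ny * g x)%:E) ->
  dcoef f a b ny al = fine (iint (EFin \o g) (Rbox R al)).
Proof.
move=> N0 ab ny1 ig Th; have uB := @unit_box_Rbox R _ _ al N0.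
pose K := (1 + ny) / 2 * b - (1 - ny) / 2 * a.
have E : iint (fun x => \int[@lebesgue_measure R]_(y in `[a, b]) (ThetaR (f x y))%:E)%E (Rbox R al)
   = ((- ny)%:E * iint (EFin \o g) (Rbox R al) + (K * Delta R N ^+ n)%:E)%E.
  rewrite -(volume_Rbox R al) -iint_cst// -iint_linear//; last exact: iintegrable_cst.
  apply: iint_ext => x xB; rewrite Th; last exact: in_box_cube xB.
  by congr (_ %:E); rewrite /K; ring.
rewrite /dcoef E -(fineK (iintegrable_fin_num ig)) -EFinM -EFinD /=.
by rewrite /K; case: ny1 => ->; field.
Qed.

(** For r >= 0 this is the absolute value of the term at the corner (r, ..., r), its largest value
    on the cube of radius r. *)
Definition majorant (R : realType) (n : nat) (c : ('I_n -> nat) -> R) (r : R)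
    (be : 'I_n -> nat) : R :=
  `|c be| * \prod_(k < n) r ^+ be k.

Lemma majorantP (R : realType) (n : nat) (c : ('I_n -> nat) -> R) (r : R)
    (be : 'I_n -> nat) (x : n.-tuple R) :
  in_cube r x -> `|c be * mono x be| <= majorant c r be.
Proof. by move=> xr; rewrite normrM ler_wpM2l// mono_le. Qed.

Definition interp_bound (R : realType) (d : R) : R :=
  1 + (1 + d) * (1 / d + 2 / d ^+ 2).

(** The error on a monomial is zero when all exponents are below N, and is otherwise bounded through
    C^n + 1, with C the constant [interp_bound d]; the n-th power comes from the tensor product.
    Summation leaves the tail of a convergent series, independent of [x]. *)
Lemma avg_op_dist (R : realType) (n : nat) (c : ('I_n -> nat) -> R) (d S : R)
    (g : n.-tuple R -> R) (N : nat) (x : n.-tuple R) :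
  0 < d -> measurable_fun [set: n.-tuple R] g ->
  (forall z, in_cube 1 z -> ps_partial c z M @[M --> \oo] --> g z) ->
  psum (majorant c (1 + d)) @ \oo --> S ->
  (forall M, psum (majorant c (1 + d)) M <= S) ->
  (0 < N)%N -> in_cube 1 x ->
  `|avg_op x (fun al : {ffun 'I_n -> 'I_N} => fine (iint (EFin \o g) (Rbox R al))) - g x|
    <= (interp_bound d ^+ n + 1) * (S - psum (majorant c (1 + d)) N.-1).
Proof.
move=> d0 mg cg WS leS N0 xc; set W := majorant c (1 + d) in WS leS *.
have cube_le z : in_cube 1 z -> in_cube (1 + d) z.
  by move=> zc k; rewrite (le_trans (zc k))// lerDl ltW.
have tail z M : in_cube 1 z -> `|g z - ps_partial c z M| <= S - psum W M.
  move=> zc; apply: (dist_lim_le (N := M) (cg z zc)) => M' MM'.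
  apply: (@le_trans _ _ (psum W M' - psum W M)); last by rewrite lerD2r leS.
  apply: (psum_diff_le (F := fun be => c be * mono z be)) => // be; by apply: majorantP; exact: cube_le.
(* Cell integrals of the partial sums: finite combinations of products of one-variable moments, to
   which [avg_op_prod] applies. *)
pose D M (al : {ffun 'I_n -> 'I_N}) : R :=
  \sum_(be : {ffun 'I_n -> 'I_M.+1})
    c (fun k => val (be k)) * \prod_(k < n) cell_moment R N (al k) (be k).
have DE M al : iintegrable (Rbox R al) (fun z => ps_partial c z M) /\
    iint (fun z => (ps_partial c z M)%:E) (Rbox R al) = (D M al)%:E.
  have uB := @unit_box_Rbox R _ _ al N0.
  have [i1 i2] := iintegrable_sum
    (index_enum {ffun 'I_n -> 'I_M.+1}) (fun be => c (fun k => val (be k))) uB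
    (fun be : {ffun 'I_n -> 'I_M.+1} => iintegrable_mono (fun k => val (be k)) uB).
  split; first exact: i1.
  rewrite [LHS]i2 /D -sumEFin; apply: eq_bigr => be _.
  rewrite EFinM; congr (_ * _)%E; rewrite iint_mono//; congr (_ %:E).
  by apply: eq_bigr => k _; rewrite tnth_mktuple.
(* Uniform convergence of the partial sums on the cube passes to the integrals over a cell of finite
   volume. *)
have cvD al : D ^~ al @ \oo --> fine (iint (EFin \o g) (Rbox R al)).
  have uB := @unit_box_Rbox R _ _ al N0.
  have bound M : `|fine (iint (EFin \o g) (Rbox R al)) - D M al|
      <= (S - psum W M) * Delta R N ^+ n.
    have [iP PE] := DE M al.
    have mh : measurable_fun [set: n.-tuple R] (fun z => -1 * ps_partial c z M + g z).
      apply: measurable_funD mg; apply: measurable_funM; last exact: iP.1.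
      exact: measurable_cst.
    have hb z : in_box (Rbox R al) z -> `|-1 * ps_partial c z M + g z| <= S - psum W M.
      by move=> /(in_box_cube uB) zc; rewrite mulN1r addrC; exact: tail.
    have [ih] := iintegrable_bounded uB mh hb.
    have ig : iintegrable (Rbox R al) g.
      have := iintegrable_linear 1 iP ih.
      by congr iintegrable; apply/funext => z; ring.
    rewrite volume_Rbox /comp (iint_linear (-1) iP ig) /comp PE.
    rewrite -(fineK (iintegrable_fin_num ig)) -EFinM -EFinD lee_fin.
    by rewrite mulN1r addrC.
  have e0 : (fun M => (S - psum W M) * Delta R N ^+ n) @ \oo --> 0.
    rewrite -(mul0r (Delta R N ^+ n)) -(subrr S).
    by apply: cvgM; [apply: cvgB; [exact: cvg_cst|exact: WS]|exact: cvg_cst].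
  apply/cvgrPdist_le => e epos; move/cvgrPdist_le : e0 => /(_ e epos).
  apply: filterS => M; rewrite sub0r normrN => h.
  by apply: le_trans (bound M) (le_trans (ler_norm _) h).
pose F be := c be * (\prod_(k < n) avg_interp N (be k) (tnth x k) - mono x be).
have FE M : avg_op x (D M) - ps_partial c x M = psum F M.
  rewrite avg_op_sum /ps_partial /psum -sumrB; apply: eq_bigr => be _.
  by rewrite avg_op_prod /F mulrBr.
have lim : (fun M => avg_op x (D M) - ps_partial c x M) @ \oo -->
    avg_op x (fun al : {ffun 'I_n -> 'I_N} => fine (iint (EFin \o g) (Rbox R al))) - g x.
  by apply: cvgB (cg x xc); exact: cvg_avg_op.
rewrite -[X in `|X|]subr0; apply: (dist_lim_le (N := N.-1) lim) => M NM.
(* Order N - 1 keeps every exponent below N, where the interpolation is exact. *)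
have F0 : psum F N.-1 = 0.
  rewrite /psum big1// => be _; rewrite /F [X in X - _](_ : _ = mono x (fun k => val (be k))).
    by rewrite subrr mulr0.
  apply: eq_bigr => k _; rewrite avg_interp_exact//.
  by rewrite (leq_trans (ltn_ord _))// prednK.
have FW be : `|F be| <= (interp_bound d ^+ n + 1) * W be.
  rewrite normrM mulrCA ler_wpM2l// mulrDl mul1r (le_trans (ler_normB _ _))//.
  apply: lerD; last by apply: mono_le; exact: cube_le.
  rewrite -[n in _ ^+ n]card_ord -prodr_const -big_split/= normr_prod.
  by apply: ler_prod => k _; rewrite normr_ge0/=; exact: avg_interp_le.
rewrite FE subr0 -[psum F M]subr0 -F0.
apply: le_trans (psum_diff_le NM FW) _.
have psumZ M' : psum (fun be => (interp_bound d ^+ n + 1) * W be) M' =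
    (interp_bound d ^+ n + 1) * psum W M'.
  by rewrite /psum mulr_sumr.
rewrite !psumZ -mulrBr ler_wpM2l ?lerD2r//.
rewrite addr_ge0// exprn_ge0// /interp_bound addr_ge0// mulr_ge0//; first lra.
by rewrite addr_ge0// divr_ge0// ?exprn_ge0// ltW.
Qed.

Theorem theorem4p2 (R : realType) (n : nat) (f : n.-tuple R -> R -> R)
    (a b ny : R) (g : n.-tuple R -> R) :
  a < b ->
  cont_on f a b ->
  assumption1 f a b ->
  ny_spec f a b ny ->
  (* g : R -> I is the unique implicit function *)
  (forall x, in_cube 1 x -> a <= g x <= b /\ f x (g x) = 0) ->
  (forall x y, in_cube 1 x -> a <= y <= b -> f x y = 0 -> y = g x) ->
  (* the power series of g at 0 converges on [-1-delta, 1+delta]^n *)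
  (exists2 delta : R, 0 < delta &
     exists c : ('I_n -> nat) -> R,
       (forall x, in_cube (1 + delta) x ->
          exists B : R, forall M, ps_abs_partial c x M <= B) /\
       (forall x, in_cube 1 x -> ps_partial c x M @[M --> \oo] --> g x)) ->
  (* conclusion: tilde g_N -> g weak-star in L^oo(R) *)
  forall phi : n.-tuple R -> R,
    measurable_fun [set: n.-tuple R] phi ->
    (iint (fun x => (`|phi x|)%:E) (cube R n) < +oo)%E ->
    (fun N => iint (fun x => (gtilde N f a b ny x * phi x)%:E) (cube R n)) @ \oo
      --> iint (fun x => (g x * phi x)%:E) (cube R n).
Proof.
move=> ab cf assum nyE groot guniq [d d0 [c [absc cg]]] phi mphi iphi'.
have iphi : iintegrable (cube R n) phi by [].
have [gb mgb gbE] := measurable_extension cg.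
have cgb x : in_cube 1 x -> ps_partial c x M @[M --> \oo] --> gb x.
  by move=> xc; rewrite gbE//; exact: cg.
(* The sums of absolute values at the corner with all coordinates 1 + d are exactly the sums of the
   majorant. *)
have [B0 WB0] : exists B0, forall M, psum (majorant c (1 + d)) M <= B0.
  have [|B0 hB] := absc [tuple 1 + d | i < n].
    by move=> k; rewrite tnth_mktuple ger0_norm// addr_ge0// ltW.
  exists B0 => M; apply: le_trans (hB M); rewrite le_eqVlt; apply/orP; left.
  apply/eqP; apply: eq_bigr => be _.
  rewrite normrM /majorant; congr (_ * _).
  rewrite /mono normr_prod; apply: eq_bigr => k _.
  by rewrite tnth_mktuple ger0_norm// exprn_ge0// addr_ge0// ltW.
have W0 be : 0 <= majorant c (1 + d) be.
  by apply: mulr_ge0 => //; apply: prodr_ge0 => k _; rewrite exprn_ge0// addr_ge0// ltW.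
have [S WS leS] := ps_tail W0 WB0.
pose K := interp_bound d ^+ n + 1.
pose eps N := K * (S - psum (majorant c (1 + d)) N).
have K0 : 0 <= K.
  rewrite addr_ge0// exprn_ge0// /interp_bound addr_ge0// mulr_ge0//; first lra.
  by rewrite addr_ge0// divr_ge0// ?exprn_ge0// ltW.
have eps0 N : 0 <= eps N by rewrite mulr_ge0// subr_ge0.
have cv_eps : eps @ \oo --> 0.
  rewrite -(mulr0 K) -(subrr S).
  by apply: cvgM; [exact: cvg_cst|apply: cvgB; [exact: cvg_cst|exact: WS]].
have gb_bound x : in_cube 1 x -> `|gb x| <= Num.max `|a| `|b|.
  move=> xc; rewrite gbE//; have [/andP[ag gb'] _] := groot x xc.
  rewrite le_max !ler_norml; case: (leP 0 (g x)) => gx.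
    by apply/orP; right; rewrite ger0_norm; lra.
  by apply/orP; left; rewrite ltr0_norm; lra.
have ny1 : ny = 1 \/ ny = -1 by case: nyE => [[]|[]]; [left|right].
have Theta x : in_cube 1 x ->
    (\int[@lebesgue_measure R]_(y in `[a, b]) (ThetaR (f x y))%:E)%E =
    ((1 + ny) / 2 * b - (1 - ny) / 2 * a - ny * gb x)%:E.
  move=> xc; have [gx fgx] := groot x xc.
  rewrite gbE//; apply: (ThetaR_integral xc cf ab (assum x xc) nyE gx fgx).
  by move=> y; exact: guniq.
(* By [dcoef_integral], [gtilde] is [avg_op] applied to the cell integrals of [gb], which gives an
   error bound uniform on the cube. *)
have dist N x : (0 < N)%N -> in_cube 1 x ->
    `|gtilde N f a b ny x - gb x| <= eps N.-1.
  move=> N0 xc; have := avg_op_dist d0 mgb cgb WS leS N0 xc.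
  congr (`|_ - _| <= _); apply: eq_bigr => be _; congr (_ * _ * _).
  apply: eq_bigr => al _; congr (_ * _).
  rewrite (dcoef_integral N0 ab ny1 _ Theta)//.
  have uB := @unit_box_Rbox R _ _ al N0.
  apply: (iintegrable_bounded uB mgb _).1 => z /(in_box_cube uB).
  exact: gb_bound.
have max0 : 0 <= Num.max `|a| `|b| by rewrite le_max normr_ge0.
have [igphi _] := iintegrable_mul_bounded mgb iphi max0
  (fun x xB => gb_bound x (proj1 (in_box_cubeE x) xB)).
(* The limit is finite, so convergence in the extended reals reduces to convergence of a real
   sequence. *)
have -> : iint (fun x => (g x * phi x)%:E) (cube R n) =
    (fine (iint (fun x => (gb x * phi x)%:E) (cube R n)))%:E.
  rewrite fineK; last exact: iintegrable_fin_num igphi.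
  by apply: iint_ext => x /in_box_cubeE xc; rewrite gbE.
(* The error bound is stated for N > 0, hence the shift by one. *)
rewrite -cvg_shiftS/=.
pose s N := fine (iint (fun x => ((gtilde N.+1 f a b ny x - gb x) * phi x)%:E) (cube R n)).
have mdiff N : measurable_fun [set: n.-tuple R] (fun x => gtilde N.+1 f a b ny x - gb x).
  by apply: measurable_funB mgb; exact: measurable_gtilde.
have diff N := iintegrable_mul_bounded (mdiff N) iphi (eps0 N)
  (fun x xB => dist N.+1 x isT (proj1 (in_box_cubeE x) xB)).
pose A := fine (iint (fun x => `|phi x|%:E) (cube R n)).
have AE : iint (fun x => `|phi x|%:E) (cube R n) = A%:E.
  by rewrite fineK//; exact: iintegrable_fin_num (iintegrable_norm iphi).
have s_le N : `|s N| <= eps N * A.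
  have [idiff le] := diff N; rewrite -lee_fin EFinM -AE; apply: le_trans le.
  by rewrite -[X in (_ <= `|X|)%E](fineK (iintegrable_fin_num idiff)).
have sE N : iint (fun x => (gtilde N.+1 f a b ny x * phi x)%:E) (cube R n) =
    (fine (iint (fun x => (gb x * phi x)%:E) (cube R n)) + s N)%:E.
  have [idiff _] := diff N.
  rewrite EFinD (fineK (iintegrable_fin_num igphi)) (fineK (iintegrable_fin_num idiff)).
  rewrite -[X in (X + _)%E]mul1e -iint_linear//.
  by apply: iint_ext => x _; congr (_ %:E); ring.
rewrite (_ : (fun N => _) = EFin \o (fun N =>
    fine (iint (fun x => (gb x * phi x)%:E) (cube R n)) + s N)); last first.
  by apply/funext => N; rewrite /= sE.
apply: cvg_EFin; first by near=> N.
rewrite -[X in _ --> X]addr0; apply: cvgD; first exact: cvg_cst.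
apply/cvgrPdist_le => e e0.
have epsA : (fun N => eps N * A) @ \oo --> 0.
  by rewrite -(mul0r A); apply: cvgM cv_eps _; exact: cvg_cst.
move/cvgrPdist_le : epsA => /(_ e e0); apply: filterS => N.
rewrite !sub0r !normrN => h.
exact: le_trans (s_le N) (le_trans (ler_norm _) h).
Unshelve. all: end_near. Qed.
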